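(* For the electric vehicle routing problem with time windows and nonlinear charging (EVRPTWNL), let $\succeq$ be the domination relations on feasible partial subpaths and on feasible partial paths defined in the context. Then: (i) Let $s_1,s_2$ be feasible partial subpaths with $s_1\succeq s_2$, and let $a\in\mathcal A$ be an arc extending both $s_1$ and $s_2$. If $s_2\oplus a$ is feasible, then $s_1\oplus a$ is feasible and $s_1\oplus a\succeq s_2\oplus a$. (ii) Let $p_1,p_2$ be feasible partial paths with $p_1\succeq p_2$, and let $s$ be a feasible subpath extending both $p_1$ and $p_2$. If $p_2\oplus s$ is feasible, then $p_1\oplus s$ is feasible and $p_1\oplus s\succeq p_2\oplus s$. (iii) Let $s_1,s_2$ be feasible subpaths with $s_1\succeq s_2$, both extending a feasible partial path $p$. If $p\oplus s_2$ is feasible, then $p\oplus s_1$ is feasible and $p\oplus s_1\succeq p\oplus s_2$.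
   Context: **Instance.** $(\mathcal V,\mathcal A)$ is a finite directed graph, $\mathcal V=\mathcal V_C\cup\mathcal V_D\cup\mathcal V_S$ a partition into customers, depots and charging stations; $T$ is the time horizon, $B$ the battery capacity, $D$ the vehicle capacity. Each arc $(i,j)$ has travel time $t_{i,j}>0$, cost $c_{i,j}>0$, battery use $b_{i,j}>0$. Each node $i$ has demand $d_i\ge 0$ and time window $[\alpha_i,\beta_i]\subseteq[0,T]$; for $i\in\mathcal V_D\cup\mathcal V_S$, $d_i=0$, $\alpha_i=0$, $\beta_i=T$. The charging function $g:\mathbb R_+\to[0,B]$ is concave, increasing, $g(0)=0$, and invertible: it is continuous, strictly increasing until it attains $B$, and $g^{-1}(b)$ is the smallest $t$ with $g(t)=b$. Set $g_T(b_1,b_2)=g^{-1}(b_2)-g^{-1}(b_1)$ and $g_C(b,t)=g(g^{-1}(b)+t)$. **Modified costs.** Given real vectors $\kappa,\mu$ (indexed by $\mathcal V_D$) and $\nu$ (indexed by $\mathcal V_C$), $\overline c_{i,j}=c_{i,j}-\mathbb 1(i\in\mathcal V_D)\kappa_i-\mathbb 1(j\in\mathcal V_D)\mu_j-\mathbb 1(j\in\mathcal V_C)\nu_j$. **Subpaths.** A partial subpath $s$ is a node sequence $(n_0,\dots,n_m)$ along arcs with $n_0\in\mathcal V_D\cup\mathcal V_S$ and $n_1,\dots,n_{m-1}\in\mathcal V_C$; it is a subpath if moreover $n_m\in\mathcal V_D\cup\mathcal V_S$. It is feasible if there is $(t_0,b_0)$ such that, with $t_{k+1}=\max\{t_k+t_{n_k,n_{k+1}},\alpha_{n_{k+1}}\}$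 and $b_{k+1}=b_k-b_{n_k,n_{k+1}}$, one has $\sum_k d_{n_k}\le D$, $b_k\in[0,B]$ and $t_k\in[\alpha_{n_k},\beta_{n_k}]$ for all $k\in\{0,\dots,m\}$. An arc $a=(n_m,n')$ extends $s$, giving $s\oplus a$ (append $n'$). Subpath resources: $\overline c(s)=\sum_{\ell=0}^{m-1}\overline c_{n_\ell,n_{\ell+1}}$; $B(s)=\sum_{\ell=0}^{m-1} b_{n_\ell,n_{\ell+1}}$; $D(s)=\sum_{\ell=0}^m d_{n_\ell}$; $T^{\rm travel}(s)=\sum_{\ell=0}^{m-1} t_{n_\ell,n_{\ell+1}}$; $T^{\rm end}_{\min}(s)=T^E_m$, where $T^E_0=\alpha_{n_0}$, $T^E_{\ell+1}=\max\{T^E_\ell+t_{n_\ell,n_{\ell+1}},\alpha_{n_{\ell+1}}\}$; $T^{\rm start}_{\max}(s)=T^L_0$, where $T^L_m=\beta_{n_m}$, $T^L_\ell=\min\{T^L_{\ell+1}-t_{n_\ell,n_{\ell+1}},\beta_{n_\ell}\}$. Let $Q(s)=\max\{T^{\rm travel}(s),\,T^{\rm end}_{\min}(s)-T^{\rm start}_{\max}(s)\}$. Subpath domination: for feasible partial subpaths with the same start and end nodes, $s_1\succeq s_2$ iff $\overline c(s_1)\le\overline c(s_2)$, $D(s_1)\le D(s_2)$, $B(s_1)\le B(s_2)$, $T^{\rm end}_{\min}(s_1)\le T^{\rm end}_{\min}(s_2)$, $T^{\rm start}_{\max}(s_1)\ge T^{\rm start}_{\max}(s_2)$ and $Q(s_1)\le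 Q(s_2)$. **Paths.** A partial path $p$ is a node sequence $(n_0,\dots,n_m)$ along arcs with $n_0\in\mathcal V_D$ and $n_1,\dots,n_{m-1}\in\mathcal V_C\cup\mathcal V_S$; it is a path if $n_m\in\mathcal V_D$. It is feasible if there are charging times $\tau_k\ge0$ (for $n_k\in\mathcal V_S$; put $\tau_k=0$ otherwise) such that with $t_0=0$, $b_0=B$, $t_{k+1}=\max\{t_k+\tau_k+t_{n_k,n_{k+1}},\alpha_{n_{k+1}}\}$, and $b_{k+1}=g_C(b_k,\tau_k)-b_{n_k,n_{k+1}}$ if $n_k\in\mathcal V_S$, $b_{k+1}=b_k-b_{n_k,n_{k+1}}$ otherwise, one has $\sum_k d_{n_k}\le D$, $b_k\in[0,B]$, $t_k\in[\alpha_{n_k},\beta_{n_k}]$ for all $k$. Partial paths considered here end at non-customer nodes, hence are uniquely concatenations $p=(s_1,\dots,s_m)$ of subpaths (or a single depot node). A subpath $s$ extends $p$ if the end node of $p$ equals the start node of $s$ and is in $\mathcal V_S$ (or $p$ is the single depot node at which $s$ starts); the concatenation is $p\oplus s$. Path resources of $p=(s_1,\dots,s_m)$: $\overline c(p)$ is the sum of $\overline c_{i,j}$ over its arcs; $D(p)$ its total load; $T^{\rm end}_{\min}(p)$ is the minimum of $T^{\rm end}_m$ subject to $T^{\rm start}_1=0$; $T^{\rm start}_k\le T^{\rm start}_{\max}(s_k)$; $T^{\rm end}_m\le T$; $T^{\rm start}_{k+1}=T^{\rm end}_k+\tau_k$; $T^{\rm end}_k=\max\{T^{\rm start}_k+T^{\rm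 travel}(s_k),T^{\rm end}_{\min}(s_k)\}$; $B^{\rm start}_1=B$; $B^{\rm end}_k=B^{\rm start}_k-B(s_k)$; $B^{\rm start}_{k+1}=g_C(B^{\rm end}_k,\tau_k)$; all variables $T^{\rm start}_k,T^{\rm end}_k,B^{\rm start}_k,B^{\rm end}_k$ ($1\le k\le m$) and $\tau_k$ ($1\le k\le m-1$) nonnegative. $B^{\rm end}_{\max}(p)$ is the maximum of $B^{\rm end}_m$ under the same constraints plus $T^{\rm end}_m=T^{\rm end}_{\min}(p)$. (For a single depot node: $\overline c=0$, $D=0$, $T^{\rm end}_{\min}=0$, $B^{\rm end}_{\max}=B$.) Path domination: for feasible partial paths with the same start and end nodes, $p_1\succeq p_2$ iff $\overline c(p_1)\le\overline c(p_2)$, $D(p_1)\le D(p_2)$ and $T^{\rm end}_{\min}(p_1)+g_T\big(B^{\rm end}_{\max}(p_1),\max\{B^{\rm end}_{\max}(p_1),B^{\rm end}_{\max}(p_2)\}\big)\le T^{\rm end}_{\min}(p_2)$. *)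

(* Defs.v *)
From mathcomp Require Import all_boot all_order all_algebra.
From mathcomp Require Import boolp classical_sets set_interval reals.
From mathcomp Require Import topology normedtype convex.

Set Implicit Arguments.
Unset Strict Implicit.
Unset Printing Implicit Defensive.

Import Order.TTheory GRing.Theory Num.Theory.
Import numFieldNormedType.Exports.

Local Open Scope classical_set_scope.
Local Open Scope ring_scope.

(* The least (greatest) element of a set of reals, when there is one; the
   junk value 0 otherwise. *)
Definition minimum {R : realType} (X : set R) : R :=
  xget 0 [set x | X x /\ lbound X x].

Definition maximum {R : realType} (X : set R) : R :=
  xget 0 [set x | X x /\ ubound X x].

Record instance (R : realType) (V : finType) := Instance {
  arc : rel V;
  customers : {set V};
  depots : {set V};
  stations : {set V};
  horizon : R;
  battery : R;
  capacity : R;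
  travel : V -> V -> R;
  cost : V -> V -> R;
  usage : V -> V -> R;
  demand : V -> R;
  tw_open : V -> R;
  tw_close : V -> R;
  charge : R -> R; (* only its values on [0, +oo[ are relevant *)

  nodes_cover : forall i, i \in customers :|: depots :|: stations;
  customers_depots_disj : customers :&: depots = finset.set0;
  customers_stations_disj : customers :&: stations = finset.set0;
  depots_stations_disj : depots :&: stations = finset.set0;

  travel_gt0 : forall i j, arc i j -> 0 < travel i j;
  cost_gt0 : forall i j, arc i j -> 0 < cost i j;
  usage_gt0 : forall i j, arc i j -> 0 < usage i j;

  demand_ge0 : forall i, 0 <= demand i;
  tw_open_ge0 : forall i, 0 <= tw_open i;
  tw_open_le_close : forall i, tw_open i <= tw_close i;
  tw_close_le : forall i, tw_close i <= horizon;
  demand_noncustomer : forall i, i \in depots :|: stations -> demand i = 0;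
  tw_open_noncustomer : forall i, i \in depots :|: stations -> tw_open i = 0;
  tw_close_noncustomer :
    forall i, i \in depots :|: stations -> tw_close i = horizon;

  charge_bounds : forall x, 0 <= x -> 0 <= charge x <= battery;
  charge0 : charge 0 = 0;
  charge_concave :
    convex_function (`[0, +oo[%classic : set R) (fun x => - charge x);
  charge_nondecreasing : forall x y, 0 <= x -> x <= y -> charge x <= charge y;
  charge_continuous : {within `[0, +oo[, continuous charge};
  charge_increasing :
    forall x y, 0 <= x -> x < y -> charge x < battery -> charge x < charge y;
  charge_full : exists2 x, 0 <= x & charge x = battery
}.

Section Routing.
Variables (R : realType) (V : finType) (I : instance R V).
Variables (kappa mu nu : V -> R).

Let VC := customers I.
Let VD := depots I.
Let VS := stations I.
Let T := horizon I.
Let B := battery I.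
Let g := charge I.

Definition charge_inv (b : R) : R := minimum [set t | 0 <= t /\ g t = b].

Definition charge_time (b1 b2 : R) : R := charge_inv b2 - charge_inv b1.

Definition charge_level (b t : R) : R := g (charge_inv b + t).

(* [kappa] and [mu] only matter on depots, [nu] only on customers. *)
Definition mod_cost (i j : V) : R :=
  cost I i j - (i \in VD)%:R * kappa i - (j \in VD)%:R * mu j
    - (j \in VC)%:R * nu j.

(* The node sequence (n_0, ..., n_m) is encoded as (n_0, [:: n_1; ...; n_m]). *)
Definition nseqt : Type := (V * seq V)%type.

Implicit Types (s p : nseqt) (a : V * V).

Definition narcs s : nat := size s.2.
Definition node s (k : nat) : V := nth s.1 (s.1 :: s.2) k.
Definition start_node s : V := s.1.
Definition end_node s : V := last s.1 s.2.

(* n_1, ..., n_{m-1} *)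
Definition interior s : seq V := behead (belast s.1 s.2).

Definition cat_arc s a : nseqt := (s.1, rcons s.2 a.2).

(* Meant for [end_node p = start_node s]; the shared node is kept once. *)
Definition cat_nseqt p s : nseqt := (p.1, p.2 ++ s.2).

Definition total_cost s : R :=
  \sum_(l < narcs s) mod_cost (node s l) (node s l.+1).

Definition total_usage s : R :=
  \sum_(l < narcs s) usage I (node s l) (node s l.+1).

Definition total_travel s : R :=
  \sum_(l < narcs s) travel I (node s l) (node s l.+1).

Definition total_load s : R := \sum_(l < (narcs s).+1) demand I (node s l).

Definition partial_subpath s : Prop :=
  [/\ path (arc I) s.1 s.2,
      start_node s \in VD :|: VS &
      {in interior s, forall n, n \in VC}].

Definition subpath s : Prop :=
  partial_subpath s /\ end_node s \in VD :|: VS.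

Definition feasible_subpath s : Prop :=
  partial_subpath s /\
  exists t b : nat -> R,
    [/\ forall k, (k < narcs s)%N ->
          t k.+1 = Num.max (t k + travel I (node s k) (node s k.+1))
                           (tw_open I (node s k.+1)),
        forall k, (k < narcs s)%N ->
          b k.+1 = b k - usage I (node s k) (node s k.+1),
        total_load s <= capacity I,
        forall k, (k <= narcs s)%N -> 0 <= b k <= B &
        forall k, (k <= narcs s)%N ->
          tw_open I (node s k) <= t k <= tw_close I (node s k)].

Definition arc_extends a s : Prop := arc I a.1 a.2 /\ a.1 = end_node s.

Fixpoint earliest s (l : nat) : R :=
  if l is l'.+1 then
    Num.max (earliest s l' + travel I (node s l') (node s l)) (tw_open I (node s l))
  else tw_open I (node s 0).

Definition sub_end_min s : R := earliest s (narcs s).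

(* The backward recursion defining T^L_0 for the node sequence n :: ns. *)
Fixpoint latest (n : V) (ns : seq V) : R :=
  if ns is n' :: ns' then
    Num.min (latest n' ns' - travel I n n') (tw_close I n)
  else tw_close I n.

Definition sub_start_max s : R := latest s.1 s.2.

Definition sub_duration s : R :=
  Num.max (total_travel s) (sub_end_min s - sub_start_max s).

Definition sub_dominates s1 s2 : Prop :=
  [/\ start_node s1 = start_node s2 /\ end_node s1 = end_node s2,
      total_cost s1 <= total_cost s2,
      total_load s1 <= total_load s2,
      total_usage s1 <= total_usage s2 &
      [/\ sub_end_min s1 <= sub_end_min s2,
          sub_start_max s1 >= sub_start_max s2 &
          sub_duration s1 <= sub_duration s2]].

Definition partial_path p : Prop :=
  [/\ path (arc I) p.1 p.2,
      start_node p \in VD,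
      {in interior p, forall n, n \in VC :|: VS} &
      end_node p \in VD :|: VS].

Definition feasible_path p : Prop :=
  partial_path p /\
  exists tau t b : nat -> R,
    [/\ forall k, (k <= narcs p)%N -> 0 <= tau k,
        forall k, (k <= narcs p)%N -> node p k \notin VS -> tau k = 0,
        [/\ t 0%N = 0,
            b 0%N = B,
            forall k, (k < narcs p)%N ->
              t k.+1 = Num.max (t k + tau k + travel I (node p k) (node p k.+1))
                               (tw_open I (node p k.+1)) &
            forall k, (k < narcs p)%N ->
              b k.+1 = (if node p k \in VS then charge_level (b k) (tau k) else b k)
                       - usage I (node p k) (node p k.+1)],
        total_load p <= capacity I &
        (forall k, (k <= narcs p)%N -> 0 <= b k <= B) /\
        (forall k, (k <= narcs p)%N ->
          tw_open I (node p k) <= t k <= tw_close I (node p k))].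

Definition sub_extends s p : Prop :=
  end_node p = start_node s /\ (start_node s \in VS \/ p.2 = [::]).

(* [legs_from n acc ns] cuts n :: acc ++ ns after each non-customer of ns. *)
Fixpoint legs_from (n : V) (acc ns : seq V) : seq nseqt :=
  if ns is n' :: ns' then
    if n' \in VC then legs_from n (rcons acc n') ns'
    else (n, rcons acc n') :: legs_from n' [::] ns'
  else [::].

(* The subpaths s_1, ..., s_m whose concatenation is p, each with at least one
   arc; there are none when p is a single depot. *)
Definition legs p : seq nseqt := legs_from p.1 [::] p.2.

Definition nlegs p : nat := size (legs p).

(* Indices are shifted by one: [leg p k] is s_{k+1}. *)
Definition leg p (k : nat) : nseqt := nth p (legs p) k.

Definition schedule p (tstart tend bstart bend tau : nat -> R) : Prop :=
  [/\ [/\ tstart 0%N = 0,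
          forall k, (k < nlegs p)%N -> tstart k <= sub_start_max (leg p k),
          tend (nlegs p).-1 <= T,
          forall k, (k.+1 < nlegs p)%N -> tstart k.+1 = tend k + tau k &
          forall k, (k < nlegs p)%N ->
            tend k = Num.max (tstart k + total_travel (leg p k))
                             (sub_end_min (leg p k))],
      [/\ bstart 0%N = B,
          forall k, (k < nlegs p)%N -> bend k = bstart k - total_usage (leg p k) &
          forall k, (k.+1 < nlegs p)%N ->
            bstart k.+1 = charge_level (bend k) (tau k)],
      forall k, (k < nlegs p)%N ->
        [/\ 0 <= tstart k, 0 <= tend k, 0 <= bstart k & 0 <= bend k] &
      forall k, (k.+1 < nlegs p)%N -> 0 <= tau k].

Definition path_end_min p : R :=
  if nlegs p is m.+1 then
    minimum [set x | exists tstart tend bstart bend tau : nat -> R,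
      schedule p tstart tend bstart bend tau /\ x = tend m]
  else 0.

Definition path_battery_max p : R :=
  if nlegs p is m.+1 then
    maximum [set x | exists tstart tend bstart bend tau : nat -> R,
      [/\ schedule p tstart tend bstart bend tau,
          tend m = path_end_min p & x = bend m]]
  else B.

Definition path_dominates p1 p2 : Prop :=
  [/\ start_node p1 = start_node p2 /\ end_node p1 = end_node p2,
      total_cost p1 <= total_cost p2,
      total_load p1 <= total_load p2 &
      path_end_min p1
        + charge_time (path_battery_max p1)
            (Num.max (path_battery_max p1) (path_battery_max p2))
        <= path_end_min p2].

Lemma noncustomerE n : (n \in VD :|: VS) = (n \notin VC).
Proof.
have := nodes_cover I n; rewrite !inE.
have /setP/(_ n) := customers_depots_disj I; rewrite !inE.
have /setP/(_ n) := customers_stations_disj I; rewrite !inE /VC /VD /VS.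
by case: (n \in customers I) => //=; case: (n \in depots I);
   case: (n \in stations I).
Qed.

Lemma legs_from_cat n acc ns (h : V) pre :
    {in acc, forall x, x \in VC} ->
    n \notin VC -> last n (acc ++ ns) \notin VC ->
  foldl cat_nseqt (h, pre) (legs_from n acc ns) = (h, pre ++ acc ++ ns).
Proof.
elim: ns n acc pre => [|n' ns IH] n acc pre accC nC /=.
  rewrite cats0; case: (lastP acc) accC => [|acc' x] accC; first by rewrite cats0.
  by rewrite last_rcons accC // mem_rcons mem_head.
case: ifPn => n'C lC /=.
  rewrite IH ?cat_rcons// => x; rewrite mem_rcons inE => /predU1P[->//|].
  exact: accC.
rewrite /cat_nseqt /= IH//=; first by rewrite -catA cat_rcons.
by move: lC; rewrite last_cat.
Qed.

Lemma legs_cat p : partial_path p -> foldl cat_nseqt (p.1, [::]) (legs p) = p.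
Proof.
case: p => n ns [/= _ nD _]; rewrite noncustomerE => lC.
by rewrite legs_from_cat// -noncustomerE inE nD.
Qed.

Lemma legs_from_subpath n acc ns :
    {in acc, forall x, x \in VC} -> n \notin VC -> path (arc I) n (acc ++ ns) ->
  {in legs_from n acc ns, forall s, subpath s /\ (0 < narcs s)%N}.
Proof.
elim: ns n acc => [//|n' ns IH] n acc accC nC /=.
rewrite -cat_rcons => pth; case: ifPn => n'C.
  apply: IH => // x; rewrite mem_rcons inE => /predU1P[->//|]; exact: accC.
move: pth; rewrite cat_path last_rcons => /andP[p1 p2] s.
rewrite inE => /predU1P[->|]; last by apply: IH => //.
rewrite /narcs /= size_rcons; split=> //; split; last first.
  by rewrite noncustomerE /end_node /= last_rcons.
split=> //=; first by rewrite noncustomerE.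
by rewrite /interior /= belast_rcons.
Qed.

Lemma legs_subpath p : partial_path p ->
  {in legs p, forall s, subpath s /\ (0 < narcs s)%N}.
Proof.
case: p => n ns [/= pth nD _ _]; apply: legs_from_subpath => //.
by rewrite -noncustomerE inE nD.
Qed.

End Routing.

(* Main.v *)
Require Import Defs.
From mathcomp Require Import all_boot all_order all_algebra.
From mathcomp Require Import boolp classical_sets reals.
From mathcomp Require Import unstable interval_inference topology normedtype.
From mathcomp Require Import convex lra.

(** Domination of subpaths is compared one arc at a time. Appending an arc [a]
    to [s] turns the latest start into the minimum of the old one and of
    [tw_close a.2 - travel a - total_travel s], and the duration
    [max (total_travel s) (sub_end_min s - sub_start_max s)] into the maximum
    of the old one plus [travel a] and of [tw_open a.2 - sub_start_max s]
    ([sub_start_max_arc], [sub_duration_arc]). Both formulas preserve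
    domination. For the first, a travel time of [s1] that exceeds the one of
    [s2] is still at most [sub_end_min s2 - sub_start_max s2], and [a] can be
    followed in time from [sub_end_min s2].

    For paths, a state is a pair of an end time [t] and an end battery level
    [b]. As the inverse of the charging function is nondecreasing, the last
    inequality of path domination says that the first state has the smaller
    [t] and the smaller [t - charge_inv b] ([state_leP]), which is a preorder.
    A feasible node-by-node drive of a path and a schedule of its subpaths
    obey the same one-subpath transition [step] ([visit_cat], [reach_cat]), so
    they reach the same states ([visit_reach]).

    The core is [step_best]: from a state there is a single charging decision
    (charge enough for the subpath, then as long as the wait at the end of the
    subpath and its latest start permit) which makes the transition possible
    and its result at least as good as the result of any transition from a
    worse state along a dominated subpath. The duration of subpaths bounds the
    delay that the decision may cause ([charging_plan]), and concavity of the
    charging function ensures that a lead in charging time is not lost when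
    battery is used ([charge_inv_sub]). Hence, by induction on the subpaths,
    among the states that a path reaches one is better than all others; it is
    formed by the minimal end time and the maximal battery level of the path
    ([path_optimum]), and [step_best] again transports domination from [p1] and
    [s1] over [p2] and [s2] to their concatenations. *)

Set Implicit Arguments.
Unset Strict Implicit.
Unset Printing Implicit Defensive.

Import Order.TTheory GRing.Theory Num.Theory.
Import numFieldNormedType.Exports.

Local Open Scope classical_set_scope.
Local Open Scope ring_scope.

(** Decides linear goals with [Num.max] and [Num.min], by cases on the order of
    their arguments. *)
Ltac minmax_lra :=
  repeat match goal with
  | |- context [Num.max ?x ?y] => case: (leP x y)
  | |- context [Num.min ?x ?y] => case: (leP x y)
  end; move=> *; lra.

(** * The charging function and its inverse *)

Lemma minimumE (R : realType) (X : set R) x : X x -> lbound X x -> minimum X = x.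
Proof.
move=> Xx lbx; rewrite /minimum; apply: xget_unique; first by split.
by move=> y [Xy lby]; apply/le_anti; rewrite lby// lbx.
Qed.

Lemma maximumE (R : realType) (X : set R) x : X x -> ubound X x -> maximum X = x.
Proof.
move=> Xx ubx; rewrite /maximum; apply: xget_unique; first by split.
by move=> y [Xy uby]; apply/le_anti; rewrite uby// ubx.
Qed.

Section Charging.
Variables (R : realType) (V : finType) (I : instance R V).
Local Notation B := (battery I).
Local Notation g := (charge I).
Local Notation ginv := (charge_inv I).

Lemma battery_ge0 : 0 <= B.
Proof. by have := charge_bounds I (lexx 0); case/andP => /le_trans; apply. Qed.

(** The intermediate value theorem for the charging function. *)
Lemma charge_attains x y b : 0 <= x -> x <= y -> g x <= b <= g y ->
  exists2 z, x <= z <= y & g z = b.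
Proof.
move=> x0 xy /andP[gb bg].
have cont : {within `[x, y], continuous g}.
  have := @charge_continuous _ _ I; apply: continuous_subspaceW => z /=.
  by rewrite !in_itv /= andbT => /andP[/(le_trans x0)].
have gxy := charge_nondecreasing I x0 xy.
have [|z] := IVT (v := b) xy cont; first by rewrite min_l// max_r// gb bg.
by rewrite in_itv /= => zxy gz; exists z.
Qed.

(** On charge levels up to the battery capacity, the minimum that defines
    [charge_inv] is attained. *)
Lemma charge_inv_min b : 0 <= b <= B ->
  [/\ 0 <= ginv b, g (ginv b) = b & forall t, 0 <= t -> g t = b -> ginv b <= t].
Proof.
move=> b0B; have [x x0 gx] := charge_full I.
suff [m [m0 gm mle]] : exists m, [/\ 0 <= m, g m = b &
    forall t, 0 <= t -> g t = b -> m <= t].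
  have -> : ginv b = m by apply: minimumE => // t [t0 gt]; exact: mle.
  by split.
have [z /andP[z0 zx] gz] : exists2 z, 0 <= z <= x & g z = b.
  by apply: charge_attains => //; rewrite charge0 gx.
case/andP: b0B => b0; rewrite le_eqVlt => /predU1P[bB|bB]; last first.
  exists z; split => // t t0 gt; rewrite leNgt; apply/negP => tz.
  have gtB : g t < B by rewrite gt.
  by have := charge_increasing t0 tz gtB; rewrite gz gt ltxx.
(* At full charge, [g] may be flat: the infimum of the full-charge times is
   itself one of them, as otherwise some level below [B] would be attained
   strictly after it. *)
pose X : set R := [set t | 0 <= t /\ g t = b].
have Xlb : has_inf X by split; [exists z|exists 0 => t []].
have m0 : 0 <= inf X by apply: lb_le_inf => [|t []//]; exists z.
have mle t : 0 <= t -> g t = b -> inf X <= t.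
  by move=> t0 gt; apply: ge_inf; [case: Xlb|].
exists (inf X); split => //; apply/eqP; rewrite eq_le; apply/andP; split.
  by rewrite bB; have /andP[] := charge_bounds I m0.
rewrite leNgt; apply/negP => gmb.
have mid : g (inf X) <= (g (inf X) + b) / 2 <= g z by rewrite gz; lra.
have [w /andP[mw wz] gw] := charge_attains m0 (mle _ z0 gz) mid.
have : w <= inf X.
  apply: lb_le_inf; first by exists z.
  move=> y [y0 gy]; rewrite leNgt; apply/negP => yw.
  by have := charge_nondecreasing I y0 (ltW yw); rewrite gw gy; lra.
by move=> wm; have : g (inf X) = g w; [congr charge; lra|lra].
Qed.

(** No bound on [b] is needed, as [minimum] is 0 when there is no minimum. *)
Lemma charge_inv_ge0 b : 0 <= ginv b.
Proof. by rewrite /charge_inv /minimum; case: xgetP => [x _ [[]]|]. Qed.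

Lemma charge_invK b : 0 <= b <= B -> g (ginv b) = b.
Proof. by case/charge_inv_min. Qed.

Lemma charge_inv_le b t : 0 <= b -> 0 <= t -> b <= g t -> ginv b <= t.
Proof.
move=> b0 t0 bgt.
have bB : 0 <= b <= B.
  by rewrite b0 (le_trans bgt)//; have /andP[] := charge_bounds I t0.
have [i0 gi imin] := charge_inv_min bB.
rewrite leNgt; apply/negP => tlt.
have gtb : g t <= b by rewrite -gi charge_nondecreasing// ltW.
have := imin _ t0 (le_anti _); rewrite gtb bgt leNgt tlt.
by move=> /(_ isT).
Qed.

Lemma charge_inv_homo b1 b2 : 0 <= b1 -> b1 <= b2 -> b2 <= B -> ginv b1 <= ginv b2.
Proof.
move=> b1_0 b12 b2B; have b2r : 0 <= b2 <= B by rewrite b2B (le_trans b1_0).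
by apply: charge_inv_le => //; rewrite ?charge_invK ?charge_inv_ge0.
Qed.

(** By concavity, charging for a given time brings no more from a higher level:
    [y] and [x + d] are convex combinations of [x] and [y + d] with exchanged
    weights. *)
Lemma charge_diff_decreasing x y d : 0 <= x -> x <= y -> 0 <= d ->
  g (y + d) - g y <= g (x + d) - g x.
Proof.
move=> x0 xy d0.
have [->|yx] := eqVneq y x; first by [].
have ltxy : x < y by rewrite lt_neqAle eq_sym yx.
have e0 : 0 < y + d - x by lra.
pose l := d / (y + d - x).
have l0 : 0 <= l by apply: divr_ge0; lra.
have l1 : l <= 1 by rewrite ler_pdivrMr//; lra.
have le : l * (y + d - x) = d by rewrite mulfVK// gt_eqF.
pose i := Itv01 l0 l1; pose j := Itv01 (onem_ge0 l1) (onem_le1 l0).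
have xI : x \in (`[0, +oo[%classic : set R) by rewrite inE /= in_itv /= andbT.
have yI : y + d \in (`[0, +oo[%classic : set R).
  by rewrite inE /= in_itv /= andbT; lra.
have := charge_concave I i xI yI; have := charge_concave I j xI yI.
have -> : @conv R (convex_lmodType R^o) j x (y + d) = x + d.
  by transitivity ((1 - l) * x + (1 - l).~ * (y + d)) => //; rewrite onemK; nra.
have -> : @conv R (convex_lmodType R^o) i x (y + d) = y.
  by transitivity (l * x + (1 - l) * (y + d)) => //; nra.
rewrite !convRE /= onemK /onem.
by nra.
Qed.

(** After charging from empty for times [x <= y] and using [u], the gap
    between the two levels, measured in charging time, is at most [y - x]. *)
Lemma charge_inv_sub x y u : 0 <= x -> x <= y -> 0 <= u -> u <= g x ->
  ginv (g y - u) <= ginv (g x - u) + (y - x).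
Proof.
move=> x0 xy u0 ugx.
have /andP[_ gxB] := charge_bounds I x0.
have p0 : 0 <= g x - u <= B by lra.
have gxy := charge_nondecreasing I x0 xy.
have [i0 gi _] := charge_inv_min p0.
have ix : ginv (g x - u) <= x by apply: charge_inv_le => //; lra.
apply: charge_inv_le; [lra|lra|].
have := @charge_diff_decreasing _ x (y - x) i0 ix.
have -> : x + (y - x) = y by lra.
by rewrite gi => /(_ _); lra.
Qed.

End Charging.

(** * Node sequences and sums over their arcs *)

Section NodeSequences.
Variables (R : realType) (V : finType).
Implicit Types (p s : nseqt V) (f : V -> V -> R) (n x : V) (ns : seq V).

Lemma narcs_cat p s : narcs (cat_nseqt p s) = (narcs p + narcs s)%N.
Proof. exact: size_cat. Qed.

Lemma node_narcs s : node s (narcs s) = end_node s.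
Proof. by rewrite /node /narcs -[size _]/(size (s.1 :: s.2)).-1 nth_last. Qed.

Lemma end_node_cat p s : end_node p = start_node s ->
  end_node (cat_nseqt p s) = end_node s.
Proof. by rewrite /end_node last_cat => ->. Qed.

Lemma node_cat_l p s k : (k <= narcs p)%N -> node (cat_nseqt p s) k = node p k.
Proof. by move=> kp; rewrite /node /= -cat_cons nth_cat /= ltnS kp. Qed.

Lemma node_cat_r p s k : end_node p = start_node s -> (k <= narcs s)%N ->
  node (cat_nseqt p s) (narcs p + k) = node s k.
Proof.
move=> ps; case: k => [|k] ks.
  by rewrite addn0 node_cat_l// node_narcs ps.
rewrite addnS /node /= nth_cat -[size p.2]/(narcs p) ltnNge leq_addr /=.
by rewrite addKn; apply: set_nth_default.
Qed.

(** The sum of [f] over the arcs of [s]: the common form of [total_cost],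
    [total_usage] and [total_travel]. *)
Definition arc_sum f s : R :=
  \sum_(l < narcs s) f (node s l) (node s l.+1).

Lemma arc_sum_nil f n : arc_sum f (n, [::]) = 0.
Proof. by rewrite /arc_sum big_ord0. Qed.

Lemma node_cons n x ns k : (k <= size ns)%N ->
  node ((n, x :: ns) : nseqt V) k.+1 = node ((x, ns) : nseqt V) k.
Proof. by move=> ks; rewrite /node /=; apply: set_nth_default. Qed.

Lemma arc_sum_cons f n x ns : arc_sum f (n, x :: ns) = f n x + arc_sum f (x, ns).
Proof.
rewrite /arc_sum /narcs /= big_ord_recl; congr (_ + _).
by apply: eq_bigr => l _; rewrite /= !node_cons// ltnW.
Qed.

Lemma arc_sum_cat f p s : end_node p = start_node s ->
  arc_sum f (cat_nseqt p s) = arc_sum f p + arc_sum f s.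
Proof.
case: p s => n ns [m ms]; rewrite /cat_nseqt /end_node /start_node /=.
elim: ns n => [n /= ->|x ns IH n /= /IH e]; first by rewrite arc_sum_nil add0r.
by rewrite !arc_sum_cons e addrA.
Qed.

Lemma arc_sum_ge0 (e : rel V) f s : (forall i j, e i j -> 0 < f i j) ->
  path e s.1 s.2 -> 0 <= arc_sum f s.
Proof.
case: s => n ns /= f0; elim: ns n => [|x ns IH] n /=; first by rewrite arc_sum_nil.
by move=> /andP[nx /IH]; rewrite arc_sum_cons; apply: addr_ge0; exact/ltW/f0.
Qed.

Lemma arc_sum_gt0 (e : rel V) f s : (forall i j, e i j -> 0 < f i j) ->
  path e s.1 s.2 -> (0 < narcs s)%N -> 0 < arc_sum f s.
Proof.
case: s => n [//|x ns] f0 /= /andP[nx pns] _; rewrite arc_sum_cons.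
by apply: ltr_wpDr; [exact: (@arc_sum_ge0 e)|exact: f0].
Qed.

Lemma node_arc (e : rel V) s k : path e s.1 s.2 -> (k < narcs s)%N ->
  e (node s k) (node s k.+1).
Proof. by move=> /pathP => /(_ s.1 k); exact. Qed.

(** The sum of [f] over the first [k] arcs of [s]. *)
Definition prefix_sum f s (k : nat) : R := \sum_(l < k) f (node s l) (node s l.+1).

Lemma prefix_sumS f s k :
  prefix_sum f s k.+1 = prefix_sum f s k + f (node s k) (node s k.+1).
Proof. by rewrite /prefix_sum big_ord_recr. Qed.

Lemma prefix_sum_le (e : rel V) f s j k : (forall i j, e i j -> 0 < f i j) ->
  path e s.1 s.2 -> (j <= k)%N -> (k <= narcs s)%N ->
  prefix_sum f s j <= prefix_sum f s k.
Proof.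
move=> f0 pth; elim: k => [|k IH]; first by rewrite leqn0 => /eqP->.
rewrite leq_eqVlt => /predU1P[->//|jk] ks.
rewrite prefix_sumS (le_trans (IH jk (ltnW ks)))// lerDl.
exact/ltW/f0/node_arc.
Qed.

Lemma prefix_sum_ge0 (e : rel V) f s k : (forall i j, e i j -> 0 < f i j) ->
  path e s.1 s.2 -> (k <= narcs s)%N -> 0 <= prefix_sum f s k.
Proof.
move=> f0 pth ks; have := prefix_sum_le f0 pth (leq0n k) ks.
by rewrite {1}/prefix_sum big_ord0.
Qed.

Lemma prefix_sum_cons f n x ns k : (k <= size ns)%N ->
  prefix_sum f ((n, x :: ns) : nseqt V) k.+1 =
  f n x + prefix_sum f ((x, ns) : nseqt V) k.
Proof.
move=> kns; rewrite /prefix_sum big_ord_recl; congr (_ + _).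
apply: eq_bigr => l _; have lk := leq_trans (ltn_ord l) kns.
by rewrite /= !node_cons// ltnW.
Qed.

End NodeSequences.

(** * Cutting a path into subpaths *)

Section Legs.
Variables (R : realType) (V : finType) (I : instance R V).
Local Notation VC := (customers I).
Local Notation VD := (depots I).
Local Notation VS := (stations I).
Implicit Types (p s : nseqt V).

Lemma total_loadE s : total_load I s =
  demand I (start_node s) + arc_sum (fun _ j => demand I j) s.
Proof. by rewrite /total_load big_ord_recl. Qed.

Lemma total_load_cat p s : end_node p = start_node s ->
  start_node s \in VD :|: VS ->
  total_load I (cat_nseqt p s) = total_load I p + total_load I s.
Proof.
move=> ps sDS; rewrite !total_loadE arc_sum_cat// (demand_noncustomer sDS).
by rewrite add0r addrA.
Qed.

Lemma depot_notin_stations n : n \in VD -> n \notin VS.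
Proof.
move=> nD; apply/negP => nS; have /setP/(_ n) := depots_stations_disj I.
by rewrite !inE nD nS.
Qed.

Lemma subpath_rcons s : subpath I s -> (0 < narcs s)%N ->
  exists n ms e, [/\ s = (n, rcons ms e), n \notin VC, e \notin VC &
    {in ms, forall x, x \in VC}].
Proof.
case: s => n ns [[/= pth nDS intC] eDS].
case: (lastP ns) pth intC eDS => [//|ms e] pth intC eDS _.
exists n, ms, e; split=> //; rewrite -?noncustomerE//.
  by move: eDS; rewrite /end_node /= last_rcons.
by move=> x xms; apply: intC; rewrite /Defs.interior /= belast_rcons.
Qed.

Lemma legs_from_rcons n acc ms e : {in ms, forall x, x \in VC} -> e \notin VC ->
  legs_from I n acc (rcons ms e) = [:: (n, acc ++ rcons ms e)].
Proof.
elim: ms acc => [|x ms IH] acc msC eC /=; first by rewrite (negPf eC) cats1.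
rewrite msC ?mem_head// IH ?cat_rcons// => y yms.
by apply: msC; rewrite inE yms orbT.
Qed.

(** Legs never run across a non-customer, so they may be computed separately on
    its two sides. *)
Lemma legs_from_cat_noncustomer n acc ns ms :
    {in acc, forall x, x \in VC} -> last n (acc ++ ns) \notin VC ->
  legs_from I n acc (ns ++ ms) =
  legs_from I n acc ns ++ legs_from I (last n ns) [::] ms.
Proof.
elim: ns n acc => [|x ns IH] n acc accC /=.
  rewrite cats0; case: (lastP acc) accC => [//|acc' y] accC.
  by rewrite last_rcons accC// mem_rcons mem_head.
rewrite -cat_rcons => lC; case: ifPn => xC.
  have accC' : {in rcons acc x, forall y, y \in VC}.
    by move=> y; rewrite mem_rcons inE => /predU1P[->//|/accC].
  rewrite IH//; case: ns lC {IH} => //=.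
  by rewrite cats0 last_rcons xC.
by rewrite IH//; move: lC; rewrite last_cat last_rcons.
Qed.

Lemma legs_cat_nseqt p s : partial_path I p -> subpath I s -> (0 < narcs s)%N ->
  end_node p = start_node s -> legs I (cat_nseqt p s) = rcons (legs I p) s.
Proof.
move=> [_ _ _ eDS] ss s0 ps; have [n [ms [e [sE nC eC msC]]]] := subpath_rcons ss s0.
rewrite /legs /= legs_from_cat_noncustomer//; last first.
  by rewrite -(noncustomerE I).
by rewrite sE /= legs_from_rcons// cats1 -[last _ _]/(end_node p) ps sE.
Qed.

Lemma partial_path_cat p s : partial_path I p -> subpath I s -> (0 < narcs s)%N ->
  sub_extends I s p -> partial_path I (cat_nseqt p s).
Proof.
move=> [pp pD pint pDS] ss s0 [ps ext]; have [[sp sDS sint] seDS] := ss.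
split=> //; [|move=> x|by rewrite end_node_cat].
  by rewrite /= cat_path pp -[last _ _]/(end_node p) ps.
have [n [ms [e [sE nC eC msC]]]] := subpath_rcons ss s0.
rewrite {1}sE /Defs.interior /= -rcons_cat belast_rcons /= mem_cat => /orP[xp|/msC xC].
  case: ext => [sS|p0]; last by rewrite p0 in xp.
  move: xp ps pint; case: p pp pD pDS => h t /= _ _ _.
  case: (lastP t) => [//|t' z]; rewrite mem_rcons inE => /predU1P[->|xt'] ps pint.
    by rewrite /end_node last_rcons in ps; rewrite inE ps sS orbT.
  by apply: pint; rewrite /Defs.interior /= belast_rcons.
by rewrite inE xC.
Qed.

Lemma split_last_noncustomer n ns : n \notin VC ->
  exists pre ms, [/\ ns = pre ++ ms, last n pre \notin VC &
    {in ms, forall x, x \in VC}].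
Proof.
move=> nC; elim/last_ind: ns => [|ns x [pre [ms [nsE lC msC]]]].
  by exists [::], [::].
have [xC|xC] := boolP (x \in VC).
  exists pre, (rcons ms x); rewrite nsE rcons_cat; split=> // y.
  by rewrite mem_rcons inE => /predU1P[->|/msC].
by exists (rcons ns x), [::]; rewrite cats0 last_rcons.
Qed.

(** Every partial path is built from a single depot by appending subpaths. *)
Lemma partial_path_ind (P : nseqt V -> Prop) :
    (forall d, d \in VD -> P (d, [::])) ->
    (forall p s, partial_path I p -> subpath I s -> (0 < narcs s)%N ->
      sub_extends I s p -> P p -> P (cat_nseqt p s)) ->
  forall p, partial_path I p -> P p.
Proof.
move=> P0 Pcat p; have [m] := ubnP (narcs p); elim: m p => // m IH [n ns].
case: (lastP ns) => [|ns' e] pm [pth nD pint eDS]; first exact: P0.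
have nDS : n \in VD :|: VS by rewrite inE nD.
have nC : n \notin VC by rewrite -(noncustomerE I).
have [pre [ms [nsE lC msC]]] := split_last_noncustomer ns' nC.
rewrite /Defs.interior /= belast_rcons /= nsE in pint.
rewrite /= /end_node /= last_rcons nsE in pth eDS.
rewrite -cats1 -catA cat_path cats1 in pth; case/andP: pth => pth1 pth2.
have -> : (n, rcons ns' e) = cat_nseqt (n, pre) (last n pre, rcons ms e).
  by rewrite /cat_nseqt /= nsE rcons_cat.
have lDS : last n pre \in VD :|: VS by rewrite noncustomerE.
have intpre : {in pre, forall x, x \in VC :|: VS}.
  by move=> x xpre; apply: pint; rewrite mem_cat xpre.
have pp : partial_path I (n, pre).
  split=> // x; rewrite /Defs.interior /=; case: (lastP pre) intpre => [//|t z] it.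
  by rewrite belast_rcons /= => xt; apply: it; rewrite mem_rcons inE xt orbT.
apply: Pcat => //.
- split; last by rewrite /end_node /= last_rcons.
  by split=> //= x; rewrite /Defs.interior /= belast_rcons => /msC.
- by rewrite /narcs /= size_rcons.
- split=> //; case: (lastP pre) intpre lC => [|t z] it; first by right.
  rewrite /start_node /= last_rcons => zC; left.
  by have := it z; rewrite mem_rcons mem_head inE (negPf zC) => /(_ isT).
- apply: IH => //; rewrite ltnS in pm; apply: leq_trans pm.
  by rewrite /narcs /= size_rcons nsE size_cat ltnS leq_addr.
Qed.

End Legs.

(** * Extending a subpath by an arc *)

Section Subpaths.
Variables (R : realType) (V : finType) (I : instance R V).
Implicit Types (p s : nseqt V) (f : V -> V -> R) (n x : V) (ns : seq V) (a : V * V).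

Lemma arc_sum_arc f s a : arc_sum f (cat_arc s a) = arc_sum f s + f (end_node s) a.2.
Proof.
rewrite -[cat_arc s a]/(s.1, rcons s.2 a.2) -cats1.
rewrite (arc_sum_cat f (s := (end_node s, [:: a.2])))//.
by rewrite arc_sum_cons arc_sum_nil addr0.
Qed.

Lemma total_load_arc s a :
  total_load I (cat_arc s a) = total_load I s + demand I a.2.
Proof. by rewrite !total_loadE arc_sum_arc addrA. Qed.

Lemma narcs_arc s a : narcs (cat_arc s a) = (narcs s).+1.
Proof. by rewrite /narcs size_rcons. Qed.

Lemma node_arc_l s a k : (k <= narcs s)%N -> node (cat_arc s a) k = node s k.
Proof. by move=> ks; rewrite /node -rcons_cons nth_rcons /= ltnS ks. Qed.

Lemma node_arc_end s a : node (cat_arc s a) (narcs s).+1 = a.2.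
Proof. by rewrite -(narcs_arc s a) node_narcs /end_node last_rcons. Qed.

Lemma earliest_arc s a k : (k <= narcs s)%N ->
  earliest I (cat_arc s a) k = earliest I s k.
Proof.
elim: k => [|k IH] ks; first by rewrite /= node_arc_l.
by rewrite /= !node_arc_l// 1?ltnW// IH// ltnW.
Qed.

Lemma sub_end_min_arc s a : sub_end_min I (cat_arc s a) =
  Num.max (sub_end_min I s + travel I (end_node s) a.2) (tw_open I a.2).
Proof.
by rewrite /sub_end_min narcs_arc /= earliest_arc// node_arc_end node_arc_l// node_narcs.
Qed.

(** [sub_start_max] is defined by recursion from the end of the sequence; this
    evaluates it by recursion from the start. *)
Lemma sub_start_max_arc s a : sub_start_max I (cat_arc s a) =
  Num.min (sub_start_max I s)
          (tw_close I a.2 - travel I (end_node s) a.2 - total_travel I s).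
Proof.
case: s => n ns; rewrite /sub_start_max /cat_arc /= -[total_travel _ _]/(arc_sum _ _).
elim: ns n => [|x ns IH] n; first by rewrite arc_sum_nil /= subr0 minC.
rewrite arc_sum_cons /= IH -[end_node (x, ns)]/(end_node (n, x :: ns)).
by minmax_lra.
Qed.

Lemma total_travel_arc s a : total_travel I (cat_arc s a) =
  total_travel I s + travel I (end_node s) a.2.
Proof. exact: arc_sum_arc. Qed.

Lemma sub_duration_arc s a :
  sub_end_min I s + travel I (end_node s) a.2 <= tw_close I a.2 ->
  sub_duration I (cat_arc s a) =
  Num.max (sub_duration I s + travel I (end_node s) a.2)
          (tw_open I a.2 - sub_start_max I s).
Proof.
move=> fit; have := tw_open_le_close I a.2.
rewrite /sub_duration total_travel_arc sub_end_min_arc sub_start_max_arc.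
by minmax_lra.
Qed.

(** Leaving as early as possible, no time window of [s] is missed. *)
Definition timely s :=
  forall k, (k <= narcs s)%N -> earliest I s k <= tw_close I (node s k).

Lemma earliest_ge_open s k : tw_open I (node s k) <= earliest I s k.
Proof. by case: k => [|k] //=; rewrite le_max lexx orbT. Qed.

(** A full battery and the earliest departure witness feasibility. *)
Lemma feasible_subpathP s : feasible_subpath I s <->
  [/\ partial_subpath I s, total_load I s <= capacity I,
      total_usage I s <= battery I & timely s].
Proof.
split=> [[ps [t [b [tS bS load b0B tw]]]]|[ps load use tml]].
  split=> //.
    have bE k : (k <= narcs s)%N -> b k = b 0%N - prefix_sum (usage I) s k.
      elim: k => [|k IH] ks; first by rewrite /prefix_sum big_ord0 subr0.
      by rewrite bS// IH 1?ltnW// prefix_sumS opprD addrA.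
    have /andP[_ b0] := b0B 0%N isT; have /andP[bm _] := b0B _ (leqnn _).
    by move: bm; rewrite bE// -[prefix_sum _ _ _]/(total_usage I s); lra.
  have Et k : (k <= narcs s)%N -> earliest I s k <= t k.
    elim: k => [|k IH] ks; first by have /andP[] := tw 0%N isT.
    by rewrite tS//= ge_max !le_max lerD2r IH 1?ltnW//= lexx orbT.
  by move=> k ks; apply: le_trans (Et k ks) _; have /andP[] := tw k ks.
split=> //; exists (earliest I s), (fun k => battery I - prefix_sum (usage I) s k).
have [pth _ _] := ps.
split=> // [k ks|k ks|k ks].
- by rewrite prefix_sumS opprD addrA.
- have := prefix_sum_ge0 (@usage_gt0 _ _ I) pth ks.
  have := prefix_sum_le (@usage_gt0 _ _ I) pth ks (leqnn _).
  by rewrite -[prefix_sum _ _ (narcs s)]/(total_usage I s); lra.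
- by rewrite earliest_ge_open tml.
Qed.

Lemma partial_subpath_rcons n ns x : partial_subpath I (n, rcons ns x) <->
  [/\ path (Defs.arc I) n (rcons ns x), n \in depots I :|: stations I &
      {in ns, forall y, y \in customers I}].
Proof.
by rewrite /partial_subpath /Defs.interior /= belast_rcons.
Qed.

Lemma feasible_subpath_arc s1 s2 a : feasible_subpath I s1 ->
  start_node s1 = start_node s2 -> end_node s1 = end_node s2 ->
  total_load I s1 <= total_load I s2 -> total_usage I s1 <= total_usage I s2 ->
  sub_end_min I s1 <= sub_end_min I s2 -> arc_extends I a s1 ->
  feasible_subpath I (cat_arc s2 a) -> feasible_subpath I (cat_arc s1 a).
Proof.
move=> /feasible_subpathP[ps1 load1 use1 tml1] st en load use tE [a_arc a1].
move=> /feasible_subpathP[ps2 load2 use2 tml2]; apply/feasible_subpathP; split.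
- case: s1 s2 ps1 ps2 st en use a1 {load1 use1 tml1 load load2 use2 tml2 tE}.
  move=> n1 ns1 [n2 ns2].
  move=> [pth1 nDS int1] /partial_subpath_rcons[_ _ int2] st en use a1.
  apply/partial_subpath_rcons; split=> //.
    by rewrite rcons_path pth1 -[last _ _]/(end_node (n1, ns1)) -a1.
  case: (lastP ns1) en int1 pth1 use {a1} => [//|ns e] /= en int1 pth1 use y.
  rewrite mem_rcons inE => /predU1P[->|yns]; last first.
    by apply: int1; rewrite /Defs.interior /= belast_rcons.
  rewrite /end_node /= last_rcons in en; rewrite en.
  (* A subpath without arcs uses no battery, so it is not dominated by one
     with arcs: [s2] ends at a customer. *)
  case: (lastP ns2) int2 use {en} => [_ |ns' e' int2 _]; last first.
    by rewrite last_rcons int2// mem_rcons mem_head.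
  rewrite -![total_usage _ _]/(arc_sum _ _) arc_sum_nil leNgt.
  by rewrite (arc_sum_gt0 (@usage_gt0 _ _ I))// /narcs size_rcons.
- by move: load2; rewrite !total_load_arc; lra.
- move: use2; rewrite -![total_usage _ _]/(arc_sum _ _) !arc_sum_arc en.
  by move: use; rewrite -![total_usage _ _]/(arc_sum _ _); lra.
- move=> k; rewrite narcs_arc leq_eqVlt => /predU1P[->|]; last first.
    by rewrite ltnS => ks; rewrite earliest_arc// node_arc_l// tml1.
  have := tml2 (narcs s2).+1; rewrite narcs_arc leqnn => /(_ isT).
  rewrite !node_arc_end -!(narcs_arc _ a) -!/(sub_end_min _ _) !sub_end_min_arc en.
  by rewrite !ge_max => /andP[? ->]; rewrite andbT; lra.
Qed.

Lemma sub_dominates_arc kappa mu nu s1 s2 a : feasible_subpath I s1 ->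
  sub_dominates I kappa mu nu s1 s2 -> arc_extends I a s1 ->
  feasible_subpath I (cat_arc s2 a) ->
  feasible_subpath I (cat_arc s1 a) /\
  sub_dominates I kappa mu nu (cat_arc s1 a) (cat_arc s2 a).
Proof.
move=> fs1 [[st en] cost load use [tE tL dur]] a1 fs2a.
have fs1a : feasible_subpath I (cat_arc s1 a) by exact: (feasible_subpath_arc (s2 := s2)).
split=> //; have fit : sub_end_min I s2 + travel I (end_node s2) a.2 <= tw_close I a.2.
  move: fs2a => /feasible_subpathP[_ _ _ /(_ (narcs s2).+1)]; rewrite narcs_arc.
  move=> /(_ (leqnn _)); rewrite node_arc_end -(narcs_arc _ a) -/(sub_end_min _ _).
  by rewrite sub_end_min_arc ge_max => /andP[].
split.
- by rewrite /start_node /end_node /cat_arc /= !last_rcons.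
- by rewrite -![total_cost _ _ _ _ _]/(arc_sum _ _) !arc_sum_arc en lerD2r.
- by rewrite !total_load_arc lerD2r.
- by rewrite -![total_usage _ _]/(arc_sum _ _) !arc_sum_arc en lerD2r.
split.
- rewrite !sub_end_min_arc en ge_max !le_max lexx orbT andbT.
  by rewrite lerD2r tE.
- (* If [s1] travels for longer than [s2], then the total travel time of [s1] is
     at most [sub_end_min s2 - sub_start_max s2]. *)
  move: dur fit tL tE; rewrite /sub_duration !sub_start_max_arc en.
  by minmax_lra.
- rewrite !sub_duration_arc// ?en//; last by apply: le_trans fit; rewrite lerD2r.
  rewrite ge_max !le_max lerD2r dur /=.
  by apply/orP; right; lra.
Qed.

End Subpaths.

(** * Driving a path node by node *)

Section States.
Variables (R : realType) (V : finType) (I : instance R V).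
Local Notation B := (battery I).
Local Notation T := (horizon I).
Local Notation VC := (customers I).
Local Notation VD := (depots I).
Local Notation VS := (stations I).
Implicit Types (p s : nseqt V) (t b : R).

(** The battery level when starting [s] from level [b] after a stop of length
    [tau]; the vehicle charges only if the stop is at a station. *)
Definition leave_level s b (tau : R) : R :=
  if start_node s \in VS then charge_level I b tau else b.

(** The vehicle may pass from time [t] and battery level [b] at the start node
    of [s] to time [t'] and level [b'] at its end node, by stopping for some
    time [tau] and then following [s]. The stop is void at a depot. *)
Definition step s t b t' b' : Prop :=
  exists2 tau : R, 0 <= tau &
    [/\ start_node s \notin VS -> tau = 0,
        t + tau <= sub_start_max I s,
        t' = Num.max (t + tau + total_travel I s) (sub_end_min I s) /\ t' <= T &
        b' = leave_level s b tau - total_usage I s /\ 0 <= b'].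

Lemma charge_level_bounds b (tau : R) : 0 <= tau -> 0 <= charge_level I b tau <= B.
Proof. by move=> tau0; apply: charge_bounds; rewrite addr_ge0// charge_inv_ge0. Qed.

Lemma leave_level_bounds s b (tau : R) : 0 <= tau -> 0 <= b <= B ->
  0 <= leave_level s b tau <= B.
Proof.
by move=> tau0 b0; rewrite /leave_level; case: ifP => // _; exact: charge_level_bounds.
Qed.

Lemma total_travel_ge0 s : path (Defs.arc I) s.1 s.2 -> 0 <= total_travel I s.
Proof. exact: (arc_sum_ge0 (@travel_gt0 _ _ I)). Qed.

Lemma total_usage_ge0 s : path (Defs.arc I) s.1 s.2 -> 0 <= total_usage I s.
Proof. exact: (arc_sum_ge0 (@usage_gt0 _ _ I)). Qed.

Lemma step_bounds s t b t' b' : subpath I s -> 0 <= t -> 0 <= b <= B ->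
  step s t b t' b' -> 0 <= t' /\ 0 <= b' <= B.
Proof.
move=> [[pth _ _] _] t0 b0 [tau tau0 [_ _ [-> _] [-> b'0]]].
have := total_travel_ge0 pth; have := total_usage_ge0 pth.
have := leave_level_bounds s tau0 b0; rewrite le_max; split; last lra.
by apply/orP; left; lra.
Qed.

Lemma sub_start_max_le s : sub_start_max I s <= T.
Proof.
case: s => n [|x ns]; rewrite /sub_start_max /= ?tw_close_le//.
by rewrite ge_min tw_close_le orbT.
Qed.

(** Departures up to [sub_start_max s] are those for which driving without
    waiting misses no time window. *)
Lemma sub_start_maxP s t : t <= sub_start_max I s <->
  (forall k, (k <= narcs s)%N ->
     t + prefix_sum (travel I) s k <= tw_close I (node s k)).
Proof.
case: s => n ns; rewrite /sub_start_max /narcs /=.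
elim: ns n t => [|x ns IH] n t /=.
  split=> [tn k|/(_ 0%N isT)]; last by rewrite /prefix_sum big_ord0 addr0.
  by rewrite leqn0 => /eqP->; rewrite /prefix_sum big_ord0 addr0.
rewrite le_min lerBrDr; split=> [/andP[/IH tx tn] [|k] kns|tk].
- by rewrite /prefix_sum big_ord0 addr0.
- by rewrite prefix_sum_cons// node_cons// addrA tx.
apply/andP; split; last by have := tk 0%N isT; rewrite /prefix_sum big_ord0 addr0.
by apply/IH => k kns; have := tk k.+1 kns; rewrite prefix_sum_cons// node_cons// addrA.
Qed.

(** As long as the vehicle has not waited, only the departure time matters; from
    the first node where it waits, it is on the earliest schedule. *)
Lemma arrival_timeE s (t : nat -> R) : tw_open I (node s 0) <= t 0%N ->
    (forall k, (k < narcs s)%N ->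
      t k.+1 = Num.max (t k + travel I (node s k) (node s k.+1))
                       (tw_open I (node s k.+1))) ->
  forall k, (k <= narcs s)%N ->
    t k = Num.max (t 0%N + prefix_sum (travel I) s k) (earliest I s k).
Proof.
move=> t0 tS; elim=> [_|k IH ks].
  by rewrite /prefix_sum big_ord0 addr0 max_l.
rewrite tS// IH 1?ltnW// prefix_sumS /=.
by minmax_lra.
Qed.

Lemma node_interior s k : subpath I s -> (0 < k < narcs s)%N -> node s k \in VC.
Proof.
case: k => // k ss /andP[_ ks].
have [n [ms [e [sE _ _ msC]]]] := subpath_rcons ss (leq_ltn_trans (leq0n _) ks).
move: ks; rewrite sE /narcs size_rcons /= ltnS => ks.
by apply: msC; rewrite /node /= nth_rcons ks mem_nth.
Qed.

Lemma customer_notin_stations n : n \in VC -> n \notin VS.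
Proof.
move=> nC; apply/negP => nS; have /setP/(_ n) := customers_stations_disj I.
by rewrite !inE nC nS.
Qed.

(** The vehicle may follow [p] node by node, as in [feasible_path], and end it
    at time [t'] with battery level [b']. *)
Definition visit p t' b' : Prop :=
  exists tau t b : nat -> R,
    [/\ [/\ forall k, (k <= narcs p)%N -> 0 <= tau k &
            forall k, (k <= narcs p)%N -> node p k \notin VS -> tau k = 0],
        [/\ t 0%N = 0,
            b 0%N = B,
            forall k, (k < narcs p)%N ->
              t k.+1 = Num.max (t k + tau k + travel I (node p k) (node p k.+1))
                               (tw_open I (node p k.+1)) &
            forall k, (k < narcs p)%N ->
              b k.+1 = (if node p k \in VS then charge_level I (b k) (tau k) else b k)
                       - usage I (node p k) (node p k.+1)],
        forall k, (k <= narcs p)%N -> 0 <= b k <= B,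
        forall k, (k <= narcs p)%N ->
          tw_open I (node p k) <= t k <= tw_close I (node p k) &
        t (narcs p) = t' /\ b (narcs p) = b'].

Lemma feasible_pathP p : feasible_path I p <->
  [/\ partial_path I p, total_load I p <= capacity I & exists t b, visit p t b].
Proof.
split=> [[pp [tau [t [b [tau0 tauS rec load [bB tw]]]]]]|].
  by split=> //; exists (t (narcs p)), (b (narcs p)), tau, t, b.
move=> [pp load [t' [b' [tau [t [b [[tau0 tauS] rec bB tw _]]]]]]].
by split=> //; exists tau, t, b.
Qed.

Lemma visit_nil d t b : d \in VD -> visit (d, [::]) t b <-> t = 0 /\ b = B.
Proof.
move=> dD; have dDS : d \in VD :|: VS by rewrite inE dD.
split=> [[tau [t' [b' [_ [t0 b0 _ _] _ _ [<- <-]]]]]//|[-> ->]].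
exists (fun=> 0), (fun=> 0), (fun=> B); split=> // k.
  by rewrite battery_ge0 lexx.
rewrite leqn0 => /eqP->.
rewrite /node /= (tw_open_noncustomer dDS) (tw_close_noncustomer dDS) lexx /=.
exact: le_trans (tw_open_ge0 I d) (le_trans (tw_open_le_close I d) (tw_close_le I d)).
Qed.

Section Extend.
Variables p s : nseqt V.
Hypothesis (ss : subpath I s).
Hypotheses (s0 : (0 < narcs s)%N) (ps : sub_extends I s p).

Let endp : end_node p = start_node s. Proof. by case: ps. Qed.
Let pths : path (Defs.arc I) s.1 s.2. Proof. by case: ss => [[]]. Qed.
Let sDS : start_node s \in VD :|: VS. Proof. by case: ss => [[]]. Qed.

Lemma visit_cat t' b' : visit (cat_nseqt p s) t' b' <->
  timely I s /\ exists t b, visit p t b /\ step s t b t' b'.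
Proof.
pose m := narcs p.
have nodel k : (k <= m)%N -> node (cat_nseqt p s) k = node p k by exact: node_cat_l.
have noder k : (k <= narcs s)%N -> node (cat_nseqt p s) (m + k) = node s k.
  exact: node_cat_r.
have nodem : node (cat_nseqt p s) m = start_node s by rewrite nodel// node_narcs.
split.
  move=> [tau [t [b [[tau0 tauS] [t0 b0 tr br] bB tw [te be]]]]].
  rewrite narcs_cat -/m in tau0 tauS tr br bB tw te be.
  have mle k : (k <= m)%N -> (k <= m + narcs s)%N by move/leq_trans; apply; exact: leq_addr.
  have mm := mle m (leqnn m).
  (* Times and levels along [s], where entry 0 is at the departure, after any
     charging, from the node shared by [p] and [s]. *)
  pose t2 k := if k is 0%N then t m + tau m else t (m + k)%N.
  pose b2 k := if k is 0%N then leave_level s (b m) (tau m) else b (m + k)%N.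
  have mid k : (k.+1 < narcs s)%N -> node s k.+1 \notin VS.
    by move=> ks; apply/customer_notin_stations/node_interior.
  have tm0 := tau0 m mm.
  have t20 : tw_open I (node s 0) <= t2 0%N.
    have := tw m mm; rewrite nodem -[start_node s]/(node s 0) /t2.
    by lra.
  have t2E := arrival_timeE t20.
  have {}t2E k : (k <= narcs s)%N ->
      t2 k = Num.max (t2 0%N + prefix_sum (travel I) s k) (earliest I s k).
    apply: t2E => -[|j] js; rewrite /t2.
      by have := tr m; rewrite nodem -addn1 noder// leq_add2l; exact.
    rewrite addnS tr ?ltn_add2l// -addnS !noder// 1?ltnW// tauS ?addr0//.
      by rewrite leq_add2l ltnW.
    by rewrite noder ?mid// ltnW.
  have b2E k : (k <= narcs s)%N -> b2 k = b2 0%N - prefix_sum (usage I) s k.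
    elim: k => [|k IH] ks; first by rewrite /prefix_sum big_ord0 subr0.
    rewrite prefix_sumS opprD addrA -IH 1?ltnW//; case: k ks {IH} => [|k] ks; rewrite /b2.
      by have := br m; rewrite nodem -addn1 noder// leq_add2l; exact.
    rewrite addnS br ?ltn_add2l// -addnS !noder// 1?ltnW//.
    by rewrite (negPf (mid _ ks)).
  have close k : (k <= narcs s)%N -> t2 k <= tw_close I (node s k).
    case: k => [|k] ks; last first.
      by have := tw (m + k.+1)%N; rewrite leq_add2l noder// => /(_ ks)/andP[].
    rewrite -[node s 0]/(start_node s) (tw_close_noncustomer sDS).
    have := t2E _ s0; have := tw (m + 1)%N; rewrite leq_add2l noder// => /(_ s0).
    have := tw_close_le I (node s 1).
    have := prefix_sum_ge0 (@travel_gt0 _ _ I) pths s0.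
    by rewrite -[t (m + 1)%N]/(t2 1%N); minmax_lra.
  split.
    by move=> k ks; apply: le_trans (close k ks); rewrite t2E// le_max lexx orbT.
  exists (t m), (b m); split.
    exists tau, t, b; split=> //; first split.
    - by move=> k /mle/tau0.
    - by move=> k km; have := tauS k (mle k km); rewrite nodel.
    - split=> // k km.
      + have := tr k; rewrite (nodel _ km) (nodel _ (ltnW km)); apply.
        exact: leq_trans km (leq_addr _ _).
      + have := br k; rewrite (nodel _ km) (nodel _ (ltnW km)); apply.
        exact: leq_trans km (leq_addr _ _).
    - by move=> k /mle/bB.
    - by move=> k km; have := tw k (mle k km); rewrite nodel.
  have t'E : t' = t2 (narcs s) by rewrite -te /t2; case: (narcs s) s0.
  have b'E : b' = b2 (narcs s) by rewrite -be /b2; case: (narcs s) s0.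
  exists (tau m) => //; split.
  - by move=> sS; apply: tauS => //; rewrite nodem.
  - apply/sub_start_maxP => k ks; apply: le_trans (close k ks).
    by rewrite t2E// le_max lexx.
  - split; first by rewrite t'E t2E.
    by rewrite t'E (le_trans (close _ (leqnn _)))// tw_close_le.
  - split; first by rewrite b'E b2E.
    by have /andP[] := bB _ (leqnn _); rewrite be.
move=> [tml [tp [bp [[tau [t [b [[tau0 tauS] [t0 b0 tr br] bB tw [te be]]]]]]]]].
move=> [x x0 [xS /sub_start_maxP xL [t'E t'T] [b'E b'0]]].
rewrite -/m in tau0 tauS tr br bB tw te be.
have bpB : 0 <= bp <= B by rewrite -be bB.
(* Beyond [p], the drive is the one that [arrival_timeE] describes. *)
pose ts j := Num.max (tp + x + prefix_sum (travel I) s j) (earliest I s j).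
pose bs j := leave_level s bp x - prefix_sum (usage I) s j.
pose tau' k := if (k < m)%N then tau k else if k == m then x else 0.
pose t2 k := if (k <= m)%N then t k else ts (k - m)%N.
pose b2 k := if (k <= m)%N then b k else bs (k - m)%N.
have tsr j : t2 (m + j.+1)%N = ts j.+1.
  by rewrite /t2 leqNgt -addSnnS leq_addr /= addSnnS addKn.
have bsr j : b2 (m + j.+1)%N = bs j.+1.
  by rewrite /b2 leqNgt -addSnnS leq_addr /= addSnnS addKn.
have tau'r j : tau' (m + j.+1)%N = 0.
  by rewrite /tau' ltnNge leq_addr /= -{2}[m]addn0 eqn_add2l.
have tau'm : tau' m = x by rewrite /tau' ltnn eqxx.
have t2m : t2 m = tp by rewrite /t2 leqnn.
have b2m : b2 m = bp by rewrite /b2 leqnn.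
have tsS j : ts j.+1 = Num.max (ts j + travel I (node s j) (node s j.+1))
                               (tw_open I (node s j.+1)).
  by rewrite /ts prefix_sumS /=; minmax_lra.
have bsS j : bs j.+1 = bs j - usage I (node s j) (node s j.+1).
  by rewrite /bs prefix_sumS opprD addrA.
have ts0 : ts 0%N = tp + x.
  have := tw m (leqnn m); rewrite node_narcs te endp -[start_node s]/(node s 0).
  by rewrite /ts /prefix_sum big_ord0 addr0 /= => /andP[o _]; rewrite max_l//; lra.
have bs0 : bs 0%N = leave_level s bp x by rewrite /bs /prefix_sum big_ord0 subr0.
exists tau', t2, b2; rewrite narcs_cat -/m; split.
- split=> k ks; rewrite /tau'; case: ltngtP => // km.
  + exact/tau0/ltnW.
  + by rewrite (nodel _ (ltnW km)) => /(tauS _ (ltnW km)).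
  + by rewrite km nodem.
- split=> //.
  + move=> k; have [km _|] := ltnP k m.
      by rewrite /t2 km (ltnW km) /tau' km (nodel _ km) (nodel _ (ltnW km)) tr.
    move=> /subnKC <-; case: (k - m)%N => [|j].
      by rewrite addn0 => _; rewrite -addn1 tsr noder// t2m tau'm nodem tsS ts0.
    rewrite ltn_add2l => js.
    by rewrite -addnS !tsr tau'r addr0 (noder _ js) (noder _ (ltnW js)).
  + move=> k; have [km _|] := ltnP k m.
      by rewrite /b2 km (ltnW km) /tau' km (nodel _ (ltnW km)) (nodel _ km) br.
    move=> /subnKC <-; case: (k - m)%N => [|j].
      by rewrite addn0 => _; rewrite -addn1 bsr noder// b2m tau'm nodem bsS bs0.
    rewrite ltn_add2l => js.
    rewrite -addnS !bsr (noder _ js) (noder _ (ltnW js)).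
    by rewrite (negPf (customer_notin_stations (node_interior ss _)))// js.
- move=> k; have [km _|mk] := leqP k m; first by rewrite /b2 km bB.
  have mk' := ltnW mk; rewrite -(subnKC mk'); rewrite -subn_gt0 in mk.
  case: (k - m)%N mk => // j _; rewrite leq_add2l => js; rewrite bsr.
  have := leave_level_bounds s x0 bpB.
  have := prefix_sum_ge0 (@usage_gt0 _ _ I) pths js.
  have := prefix_sum_le (@usage_gt0 _ _ I) pths js (leqnn _).
  by rewrite /bs -[prefix_sum _ _ (narcs s)]/(total_usage I s); lra.
- move=> k; have [km _|mk] := leqP k m; first by rewrite /t2 km nodel// tw.
  have mk' := ltnW mk; rewrite -(subnKC mk'); rewrite -subn_gt0 in mk.
  case: (k - m)%N mk => // j _; rewrite leq_add2l => js; rewrite tsr noder//.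
  rewrite /ts ge_max xL// tml// andbT le_max.
  by rewrite earliest_ge_open orbT.
- by rewrite -(prednK s0) tsr bsr (prednK s0) t'E b'E.
Qed.

End Extend.
End States.

(** * Driving a path subpath by subpath *)

Section Reach.
Variables (R : realType) (V : finType) (I : instance R V).
Local Notation B := (battery I).
Local Notation T := (horizon I).
Local Notation VC := (customers I).
Local Notation VD := (depots I).
Local Notation VS := (stations I).
Implicit Types (p s : nseqt V) (t b : R).

(** Some schedule of the subpaths of [p] ends at time [t'] with battery level
    [b']; the state of a single depot is the initial one. *)
Definition reach p t' b' : Prop :=
  if nlegs I p is m.+1 then
    exists tstart tend bstart bend tau : nat -> R,
      [/\ schedule I p tstart tend bstart bend tau, tend m = t' & bend m = b']
  else t' = 0 /\ b' = B.

Lemma nlegs_eq0 p : partial_path I p -> nlegs I p = 0%N -> p.2 = [::].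
Proof. by move=> pp /eqP/nilP e; rewrite -(legs_cat pp) e. Qed.

Lemma nlegs_cat p s : partial_path I p -> subpath I s -> (0 < narcs s)%N ->
  end_node p = start_node s -> nlegs I (cat_nseqt p s) = (nlegs I p).+1.
Proof. by move=> pp ss s0 ps; rewrite /nlegs legs_cat_nseqt// size_rcons. Qed.

Lemma leg_cat_l p s k : partial_path I p -> subpath I s -> (0 < narcs s)%N ->
  end_node p = start_node s -> (k < nlegs I p)%N ->
  leg I (cat_nseqt p s) k = leg I p k.
Proof.
move=> pp ss s0 ps kp; rewrite /leg legs_cat_nseqt// nth_rcons kp.
exact: set_nth_default.
Qed.

Lemma leg_cat_r p s : partial_path I p -> subpath I s -> (0 < narcs s)%N ->
  end_node p = start_node s -> leg I (cat_nseqt p s) (nlegs I p) = s.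
Proof.
by move=> pp ss s0 ps; rewrite /leg legs_cat_nseqt// nth_rcons ltnn eqxx.
Qed.

(** A vehicle may charge before every subpath except the first. *)
Lemma sub_extends_station p s : partial_path I p -> sub_extends I s p ->
  (start_node s \in VS) = (0 < nlegs I p)%N.
Proof.
move=> pp [ps ext]; have [_ pD _ _] := pp.
have p2S : p.2 = [::] -> start_node s \notin VS.
  by move=> p0; apply: depot_notin_stations; rewrite -ps /end_node p0.
case: posnP => [/(nlegs_eq0 pp)/p2S/negPf//|]; case: ext => [->//|].
by rewrite /nlegs /legs => ->.
Qed.

Lemma reach_cat p s t' b' : partial_path I p -> subpath I s -> (0 < narcs s)%N ->
    sub_extends I s p ->
  reach (cat_nseqt p s) t' b' <-> exists t b, reach p t b /\ step I s t b t' b'.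
Proof.
move=> pp ss s0 ext; have [ps _] := ext; have sS := sub_extends_station pp ext.
have [[pth _ _] _] := ss.
have U0 := total_usage_ge0 pth; have W0 := total_travel_ge0 pth.
have legr := leg_cat_r pp ss s0 ps.
have legl k : (k < nlegs I p)%N -> leg I (cat_nseqt p s) k = leg I p k.
  exact: leg_cat_l.
rewrite /reach /schedule /step /leave_level nlegs_cat// sS.
case: (nlegs I p) legl legr => [|m] legl legr /=.
  split.
    move=> [ts [te [bs [be [tau [[[ts0 tsL teT _ teE] [bs0 beE _] nn _] <- <-]]]]]].
    move: ts0 bs0 (tsL 0%N isT) (teE 0%N isT) (beE 0%N isT) (nn 0%N isT); rewrite legr.
    move=> -> -> L0 teE0 beE0 [_ _ _ be0].
    by exists 0, B; split=> //; exists 0 => //; rewrite addr0.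
  move=> [t [b [[-> ->] [tau tau0 [tauS tL [tE tT] [bE b0]]]]]].
  move: tauS tL tE => -> //; rewrite addr0 => tL tE.
  exists (fun=> 0), (fun=> t'), (fun=> B), (fun=> b'), (fun=> 0).
  split=> //; split=> //.
  - split=> // k; rewrite ltnS leqn0 => /eqP->; by rewrite legr.
  - by split=> // k; rewrite ltnS leqn0 => /eqP->; rewrite legr.
  - move=> k _; split=> //; rewrite ?battery_ge0//.
    by rewrite tE le_max add0r W0.
split.
  move=> [ts [te [bs [be [tau [[[ts0 tsL teT tsS teE] [bs0 beE bsS] nn tau0] <- <-]]]]]].
  have := tsS m (ltnSn _); have := teE m.+1 (ltnSn _); have := tsL m.+1 (ltnSn _).
  have := bsS m (ltnSn _); have := beE m.+1 (ltnSn _); have := tau0 m (ltnSn _).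
  have [_ _ _] := nn m.+1 (ltnSn _).
  rewrite legr => be0 taum bem bsm tsm tem tsme.
  exists (te m), (be m); split.
    exists ts, te, bs, be, tau; split=> //; split.
    - split=> //.
      + by move=> k km; rewrite -legl// tsL// ltnW.
      + have := le_trans tsm (sub_start_max_le I s); lra.
      + by move=> k km; apply: tsS; apply: ltnW.
      + by move=> k km; rewrite -legl// teE// ltnW.
    - split=> //.
      + by move=> k km; rewrite -legl// beE// ltnW.
      + by move=> k km; apply: bsS; apply: ltnW.
    - by move=> k km; apply/nn/ltnW.
    - by move=> k km; apply/tau0/ltnW.
  by exists (tau m) => //; rewrite -tsme -bsm.
move=> [t [b [[ts [te [bs [be [tau [[[ts0 tsL teT tsS teE] [bs0 beE bsS] nn tau0] tet beb]]]]]]]]].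
move=> [x x0 [_ xL [t'E t'T] [b'E b'0]]].
pose upd (f : nat -> R) y := fun k => if k == m.+1 then y else f k.
have updr f y : upd f y m.+1 = y by rewrite /upd eqxx.
have updl f y k : (k < m.+1)%N -> upd f y k = f k.
  by move=> km; rewrite /upd ltn_eqF.
exists (upd ts (t + x)), (upd te t'), (upd bs (charge_level I b x)), (upd be b').
exists (fun k => if k == m then x else tau k).
have split_last (P : nat -> Prop) :
    (forall k, (k < m.+1)%N -> P k) -> P m.+1 -> forall k, (k < m.+2)%N -> P k.
  by move=> Pl Pr k; rewrite ltnS leq_eqVlt => /predU1P[->//|]; exact: Pl.
have split_pen (P : nat -> Prop) :
    (forall k, (k.+1 < m.+1)%N -> P k) -> P m -> forall k, (k.+1 < m.+2)%N -> P k.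
  by move=> Pl Pr k; rewrite !ltnS leq_eqVlt => /predU1P[->//|]; exact: Pl.
have nm := nn m (ltnSn _).
split; rewrite ?updr//; split.
- split=> //.
  + apply: split_last => [k km|]; last by rewrite updr legr.
    by rewrite updl// legl// tsL.
  + apply: split_pen => [k km|]; last by rewrite updr updl// eqxx tet.
    by rewrite !updl// ?(ltnW km)// ltn_eqF// tsS.
  + apply: split_last => [k km|]; last by rewrite !updr legr.
    by rewrite !updl// legl// teE.
- split=> //.
  + apply: split_last => [k km|]; last by rewrite !updr legr.
    by rewrite !updl// legl// beE.
  + apply: split_pen => [k km|]; last by rewrite updr updl// eqxx beb.
    by rewrite !updl// ?(ltnW km)// ltn_eqF// bsS.
- apply: split_last => [k km|]; first by rewrite !updl//; exact: nn.
  rewrite !updr; have /andP[cl0 _] := charge_level_bounds I b x0.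
  have t0 : 0 <= t by rewrite -tet; case: nm.
  by split=> //; [lra|rewrite t'E le_max; apply/orP; left; lra].
- apply: split_pen => [k km|]; last by rewrite eqxx.
  by rewrite ltn_eqF//; exact: tau0.
Qed.

Lemma reach_bounds p t b : partial_path I p -> reach p t b -> 0 <= t /\ 0 <= b <= B.
Proof.
move=> pp; elim/(partial_path_ind (I := I)): p / pp t b => [d dD|p s pp ss s0 ext IH] t b.
  by rewrite /reach => -[-> ->]; rewrite battery_ge0 lexx.
move=> /reach_cat => /(_ pp ss s0 ext)[t1 [b1 [/IH[t10 b10] st]]].
exact: step_bounds ss t10 b10 st.
Qed.

(** The node-by-node drive must exist, as a schedule of subpaths does not by
    itself prevent the earliest schedule inside a subpath from missing a time
    window. *)
Lemma visit_reach p t b : partial_path I p -> (exists t b, visit I p t b) ->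
  visit I p t b <-> reach p t b.
Proof.
move=> pp; elim/(partial_path_ind (I := I)): p / pp t b => [d dD|p s pp ss s0 ext IH] t b.
  by move=> _; rewrite visit_nil.
move=> [t' [b' /(visit_cat ss s0 ext)[tml [t1 [b1 [v1 _]]]]]].
have v : exists t b, visit I p t b by exists t1, b1.
rewrite visit_cat// reach_cat//; split=> [[_ [t2 [b2 [/IH r2 st]]]]|].
  by exists t2, b2; split=> //; exact: r2.
by move=> [t2 [b2 [/IH r2 st]]]; split=> //; exists t2, b2; split=> //; exact: r2.
Qed.

End Reach.

(** * Domination of paths *)

Section Domination.
Variables (R : realType) (V : finType) (I : instance R V).
Local Notation B := (battery I).
Local Notation ginv := (charge_inv I).
Local Notation VS := (stations I).
Implicit Types (p s : nseqt V) (t b : R).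

(** State [(t1, b1)] is at least as good as [(t2, b2)]: it is not later, and
    neither is the time at which charging from empty would have had to start. *)
Definition state_le t1 b1 t2 b2 : Prop := t1 <= t2 /\ t1 - ginv b1 <= t2 - ginv b2.

Lemma state_le_trans t2 b2 t1 b1 t3 b3 :
  state_le t1 b1 t2 b2 -> state_le t2 b2 t3 b3 -> state_le t1 b1 t3 b3.
Proof. by move=> [? ?] [? ?]; split; lra. Qed.

(** The comparison of states in the definition of path domination. *)
Lemma state_leP t1 b1 t2 b2 : 0 <= b1 <= B -> 0 <= b2 <= B ->
  t1 + charge_time I b1 (Num.max b1 b2) <= t2 <-> state_le t1 b1 t2 b2.
Proof.
move=> /andP[b10 b1B] /andP[b20 b2B]; rewrite /state_le /charge_time.
case: (leP b1 b2) => [b12|/ltW b21].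
  have := charge_inv_homo b10 b12 b2B.
  by split; [move=> ?; split|case]; lra.
have := charge_inv_homo b20 b21 b1B.
by split; [move=> ?; split|case]; lra.
Qed.

(** The inequalities on times behind [step_best]. Here [c1] and [c2] are the
    charging times that the initial levels are worth, and [k1] is the one that
    the usage of the better subpath is worth; [w], [E] and [L] are the travel
    time, earliest end and latest start of the two subpaths. *)
Lemma charging_plan (t1 c1 k1 w1 E1 L1 t2 c2 tau2 w2 E2 L2 : R) :
    t1 <= t2 -> t1 - c1 <= t2 - c2 -> k1 <= c2 + tau2 -> 0 <= tau2 ->
    t2 + tau2 <= L2 -> L2 <= L1 -> E1 <= E2 ->
    Num.max w1 (E1 - L1) <= Num.max w2 (E2 - L2) ->
  let tau1 := Num.max 0 (Num.max (k1 - c1) (Num.min (E1 - w1) L1 - t1)) in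
  let t2' := Num.max (t2 + tau2 + w2) E2 in
  [/\ 0 <= tau1, k1 <= c1 + tau1, t1 + tau1 <= L1,
      Num.max (t1 + tau1 + w1) E1 <= t2' &
      Num.max (t1 + tau1 + w1) E1 + (c2 + tau2 - (c1 + tau1)) <= t2'].
Proof.
move=> t12 c12 k1y tau20 tL2 L12 E12 Q12; set m := Num.min _ L1 => tau1 t2'.
have Qt : t2 + tau2 + Num.max w2 (E2 - L2) <= t2'.
  by rewrite /t2'; move: tL2; clear; minmax_lra.
have /andP[ww EL] : (w1 <= t2' - (t2 + tau2)) && (E1 - L1 <= t2' - (t2 + tau2)).
  by rewrite -ge_max; lra.
have E1t : E1 <= t2' by rewrite le_max E12 orbT.
have mE : m <= E1 - w1 by rewrite ge_min lexx.
have mL : m <= L1 by rewrite ge_min lexx orbT.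
have mEL : E1 - w1 <= m \/ L1 <= m.
  by rewrite /m; case: (leP (E1 - w1) L1) => _; [left|right].
have tau1_0 : 0 <= tau1 by rewrite le_max lexx.
have tau1_k : k1 - c1 <= tau1 by rewrite !le_max lexx orbT.
have tau1_m : m - t1 <= tau1 by rewrite !le_max lexx !orbT.
have tau1L : tau1 <= t2 + tau2 - t1 \/ tau1 = m - t1.
  rewrite /tau1; case: (leP 0 (Num.max _ _)) => _; last by left; lra.
  by case: (leP (k1 - c1) (m - t1)) => _; [right|left; lra].
split=> //.
- by lra.
- by case: tau1L => tau1L; lra.
- by rewrite ge_max E1t andbT; case: tau1L => tau1L; lra.
- rewrite -lerBrDr ge_max; apply/andP; split; first lra.
  by case: mEL => mEL; lra.
Qed.

(** The state [(t1', b1')] depends only on [s1], [t1] and [b1]: a single choice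
    of charging time is best against all [s2], [t2] and [b2]. At a depot there
    is no charging, and the two levels have to agree. *)
Lemma step_best s1 t1 b1 : subpath I s1 -> 0 <= b1 <= B -> exists t1' b1',
  forall s2 t2 b2 t2' b2', subpath I s2 -> start_node s1 = start_node s2 ->
    sub_start_max I s2 <= sub_start_max I s1 ->
    sub_end_min I s1 <= sub_end_min I s2 ->
    sub_duration I s1 <= sub_duration I s2 ->
    total_usage I s1 <= total_usage I s2 ->
    0 <= b2 <= B ->
    (start_node s1 \notin VS -> b1 = b2) ->
    state_le t1 b1 t2 b2 -> step I s2 t2 b2 t2' b2' ->
  step I s1 t1 b1 t1' b1' /\ state_le t1' b1' t2' b2'.
Proof.
move=> ss1 b1B.
have [[pth1 _ _] _] := ss1; have u10 := total_usage_ge0 pth1.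
have [sS|sS] := boolP (start_node s1 \in VS); last first.
  exists (Num.max (t1 + 0 + total_travel I s1) (sub_end_min I s1)).
  exists (b1 - total_usage I s1).
  move=> s2 t2 b2 t2' b2' _ st L12 E12 Q12 U12 b2B /(_ isT) b12 [t12 c12].
  move=> [tau2 _ [tau20 tL2 [t2'E t2'T] [b2'E b2'0]]].
  rewrite /leave_level -st (negPf sS) -b12 in tau20 b2'E.
  move: (tau20 isT) => tau2E; rewrite tau2E in tL2 t2'E.
  have t12' : Num.max (t1 + 0 + total_travel I s1) (sub_end_min I s1) <= t2'.
    by rewrite t2'E; move: Q12; rewrite /sub_duration; minmax_lra.
  split.
    exists 0 => //; rewrite /leave_level (negPf sS); split=> //; first lra.
      by split=> //; lra.
    by split=> //; lra.
  split=> //.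
  have b12' : b2' <= b1 - total_usage I s1 by lra.
  have b1'B : b1 - total_usage I s1 <= B by lra.
  have := charge_inv_homo b2'0 b12' b1'B; lra.
pose c1 := ginv b1.
(* Charge enough for [s1], and then, as long as this does not delay the end of
   [s1], until its latest start. *)
pose k1 := ginv (total_usage I s1).
pose w1 := total_travel I s1; pose E1 := sub_end_min I s1; pose L1 := sub_start_max I s1.
pose tau1 := Num.max 0 (Num.max (k1 - c1) (Num.min (E1 - w1) L1 - t1)).
pose x := c1 + tau1.
exists (Num.max (t1 + tau1 + w1) E1), (charge I x - total_usage I s1).
move=> s2 t2 b2 t2' b2' ss2 st L12 E12 Q12 U12 b2B _ [t12 c12].
move=> [tau2 tau20 [_ tL2 [t2'E t2'T] [b2'E b2'0]]].
rewrite /leave_level -st sS /charge_level in b2'E.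
pose y := ginv b2 + tau2; rewrite -/y in b2'E.
have y0 : 0 <= y by rewrite addr_ge0// charge_inv_ge0.
have /andP[_ gyB] := charge_bounds I y0.
have k1y : k1 <= y by apply: charge_inv_le => //; lra.
have [tau10 k1x tL1 t12' delay] :=
  charging_plan t12 c12 k1y tau20 tL2 L12 E12 Q12.
rewrite -/tau1 -/x -/y -t2'E in tau10 k1x tL1 t12' delay.
have x0 : 0 <= x by rewrite addr_ge0// charge_inv_ge0.
have u1x : total_usage I s1 <= charge I x.
  have := charge_nondecreasing I (charge_inv_ge0 I _) k1x; rewrite charge_invK//.
  by rewrite u10; lra.
have /andP[_ gxB] := charge_bounds I x0.
split.
  exists tau1 => //; rewrite /leave_level sS; split=> //.
    by split=> //; exact: le_trans t2'T.
  by split=> //; lra.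
split=> //.
have [yx|/ltW xy] := leP y x.
  have gyx := charge_nondecreasing I y0 yx.
  have b21' : b2' <= charge I x - total_usage I s1 by lra.
  have b1'B : charge I x - total_usage I s1 <= B by lra.
  have := charge_inv_homo b2'0 b21' b1'B; lra.
have := charge_inv_sub x0 xy u10 u1x.
have b2y : b2' <= charge I y - total_usage I s1 by lra.
have yB : charge I y - total_usage I s1 <= B by lra.
have := charge_inv_homo b2'0 b2y yB; lra.
Qed.

(** A subpath that starts at a depot extends only single depots, where the
    battery is full. *)
Lemma depot_battery_eq p1 p2 s1 s2 t1 b1 t2 b2 : partial_path I p1 -> partial_path I p2 ->
    start_node s1 = start_node s2 -> sub_extends I s1 p1 -> sub_extends I s2 p2 ->
    reach I p1 t1 b1 -> reach I p2 t2 b2 ->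
  start_node s1 \notin VS -> b1 = b2.
Proof.
move=> pp1 pp2 st ext1 ext2 r1 r2 sS; move: r1 r2; rewrite /reach.
have := sub_extends_station pp1 ext1; have := sub_extends_station pp2 ext2.
rewrite -st (negPf sS); do 2 case: (nlegs I _) => //.
by move=> _ _ [_ ->] [_ ->].
Qed.

Lemma reach_optimum p : partial_path I p -> (exists t b, reach I p t b) ->
  exists t b, reach I p t b /\ forall t' b', reach I p t' b' -> state_le t b t' b'.
Proof.
move=> pp; elim/(partial_path_ind (I := I)): p / pp => [d dD _|p s pp ss s0 ext IH].
  exists 0, B; split=> // t b [-> ->]; split=> //.
move=> [t' [b' /(reach_cat _ _ pp ss s0 ext)[t1 [b1 [r1 st1]]]]].
have [|t [b [r opt]]] := IH; first by exists t1, b1.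
have [t0 b0] := reach_bounds pp r.
have [ts [bs best]] := step_best t ss b0.
have {}best t2 b2 t2' b2' : reach I p t2 b2 -> step I s t2 b2 t2' b2' ->
    step I s t b ts bs /\ state_le ts bs t2' b2'.
  move=> r2 st2; have [_ b20] := reach_bounds pp r2.
  apply: (best s t2 b2) => //; last exact: opt.
  exact: (depot_battery_eq pp pp _ ext ext r r2).
exists ts, bs; split.
  by apply/reach_cat => //; exists t, b; split=> //; case: (best _ _ _ _ r1 st1).
by move=> t2' b2' /reach_cat[]// t2 [b2 [r2 st2]]; case: (best _ _ _ _ r2 st2).
Qed.

(** The minimum and the maximum that define the resources of [p] are attained,
    in a single best state. *)
Lemma path_optimum p : partial_path I p -> (exists t b, reach I p t b) ->
  reach I p (path_end_min I p) (path_battery_max I p) /\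
  forall t b, reach I p t b -> state_le (path_end_min I p) (path_battery_max I p) t b.
Proof.
move=> pp ex; have [t [b [r opt]]] := reach_optimum pp ex.
suff [-> ->] : path_end_min I p = t /\ path_battery_max I p = b by [].
have bounds := fun t' b' => @reach_bounds _ _ I p t' b' pp.
have [_ /andP[b0 bB]] := bounds _ _ r.
rewrite /path_battery_max; move: r opt bounds; rewrite /path_end_min /reach.
case: (nlegs I p) => [[-> ->]//|m] r opt bounds.
have tE : minimum [set x | exists tstart tend bstart bend tau : nat -> R,
      schedule I p tstart tend bstart bend tau /\ x = tend m] = t.
  apply: minimumE => [|x [ts [te [bs [be [tau [sch ->]]]]]]].
    move: r => [ts [te [bs [be [tau [sch <- _]]]]]].
    by exists ts, te, bs, be, tau.
  have [|] := opt (te m) (be m); last by [].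
  by exists ts, te, bs, be, tau.
split=> //; rewrite tE; apply: maximumE.
  move: r => [ts [te [bs [be [tau [sch e <-]]]]]].
  by exists ts, te, bs, be, tau.
move=> x [ts [te [bs [be [tau [sch teE ->]]]]]].
(* At equal end times, a better state has the higher battery level. *)
have re : exists tstart tend bstart bend tau : nat -> R,
    [/\ schedule I p tstart tend bstart bend tau, tend m = t & bend m = be m].
  by exists ts, te, bs, be, tau.
have [_ /andP[e0 eB]] := bounds _ _ re.
have [_ ie] := opt _ _ re.
have iB : ginv (be m) <= ginv b by lra.
have := charge_nondecreasing I (charge_inv_ge0 I _) iB.
by rewrite !charge_invK// ?e0 ?b0.
Qed.

Lemma feasible_path_optimum p : feasible_path I p ->
  reach I p (path_end_min I p) (path_battery_max I p) /\
  forall t b, reach I p t b -> state_le (path_end_min I p) (path_battery_max I p) t b.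
Proof.
move=> /feasible_pathP[pp _ ex]; apply: path_optimum => //.
by have [t [b v]] := ex; exists t, b; apply/visit_reach.
Qed.

Lemma path_dominatesP kappa mu nu p1 p2 : feasible_path I p1 -> feasible_path I p2 ->
  path_dominates I kappa mu nu p1 p2 <->
  [/\ start_node p1 = start_node p2 /\ end_node p1 = end_node p2,
      total_cost I kappa mu nu p1 <= total_cost I kappa mu nu p2,
      total_load I p1 <= total_load I p2 &
      state_le (path_end_min I p1) (path_battery_max I p1)
             (path_end_min I p2) (path_battery_max I p2)].
Proof.
move=> f1 f2; have [r1 _] := feasible_path_optimum f1; have [r2 _] := feasible_path_optimum f2.
have [pp1 _ _] := (feasible_pathP I p1).1 f1; have [pp2 _ _] := (feasible_pathP I p2).1 f2.
have [_ b1] := reach_bounds pp1 r1; have [_ b2] := reach_bounds pp2 r2.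
by split=> -[? ? ? d]; split=> //; apply/state_leP.
Qed.

Lemma cat_nseqt_nil p s : narcs s = 0%N -> cat_nseqt p s = p.
Proof. by case: p s => n ns [m [|//]] _; rewrite /cat_nseqt /= cats0. Qed.

(** Appending a subpath cannot improve the state; needed when the dominating
    subpath is a single node and the dominated one is not. *)
Lemma step_state_le s t b t' b' : subpath I s -> 0 <= b <= B ->
  step I s t b t' b' -> state_le t b t' b'.
Proof.
move=> [[pth _ _] _] bB [tau tau0 [_ _ [t'E _] [b'E b'0]]].
have W0 := total_travel_ge0 pth; have U0 := total_usage_ge0 pth.
have tt' : t + tau <= t' by rewrite t'E le_max; apply/orP; left; lra.
split; first lra.
have /andP[_ lB] := leave_level_bounds s tau0 bB.
have b'l : b' <= leave_level I s b tau by lra.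
have := charge_inv_homo b'0 b'l lB; move: (charge_inv_ge0 I b) => c0.
rewrite /leave_level; case: ifP => _ ; last lra.
have c0' : 0 <= ginv b + tau by lra.
have := charge_inv_le (proj1 (andP (charge_bounds I c0'))) c0' (lexx _).
rewrite /charge_level; lra.
Qed.

(** Domination of paths and of subpaths carries over to concatenations. *)
Lemma path_dominates_cat kappa mu nu p1 p2 s1 s2 :
    feasible_path I p1 -> feasible_path I p2 -> path_dominates I kappa mu nu p1 p2 ->
    subpath I s1 -> feasible_subpath I s1 -> subpath I s2 ->
    sub_dominates I kappa mu nu s1 s2 ->
    sub_extends I s1 p1 -> sub_extends I s2 p2 ->
    feasible_path I (cat_nseqt p2 s2) ->
  feasible_path I (cat_nseqt p1 s1) /\
  path_dominates I kappa mu nu (cat_nseqt p1 s1) (cat_nseqt p2 s2).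
Proof.
move=> f1 f2 /(path_dominatesP kappa mu nu f1 f2)[[pst pen] pcost pload pbet] ss1 fs1 ss2.
move=> [[sst sen] scost sload suse [sE sL sQ]] ext1 ext2 fc2.
have [pp1 load1 v1] := (feasible_pathP I p1).1 f1.
have [pp2 load2 v2] := (feasible_pathP I p2).1 f2.
have [ppc2 loadc2 vc2] := (feasible_pathP I _).1 fc2.
have [ps1 _] := ext1; have [ps2 _] := ext2.
have [[_ sDS1 _] _] := ss1; have [[_ sDS2 _] _] := ss2.
have loadc : total_load I (cat_nseqt p1 s1) <= total_load I (cat_nseqt p2 s2).
  by rewrite !total_load_cat//; lra.
have costc : total_cost I kappa mu nu (cat_nseqt p1 s1) <=
             total_cost I kappa mu nu (cat_nseqt p2 s2).
  move: pcost scost; rewrite -![total_cost _ _ _ _ _]/(arc_sum _ _).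
  by rewrite !arc_sum_cat//; lra.
have endc : end_node (cat_nseqt p1 s1) = end_node (cat_nseqt p2 s2).
  by rewrite !end_node_cat.
have [rc2 _] := feasible_path_optimum fc2.
have [r1 _] := feasible_path_optimum f1.
have [_ opt2] := feasible_path_optimum f2.
suff [fc1 betc] : feasible_path I (cat_nseqt p1 s1) /\
    state_le (path_end_min I (cat_nseqt p1 s1)) (path_battery_max I (cat_nseqt p1 s1))
           (path_end_min I (cat_nseqt p2 s2)) (path_battery_max I (cat_nseqt p2 s2)).
  by split=> //; apply/path_dominatesP.
case: (posnP (narcs s2)) => [n2|n2].
  have n1 : narcs s1 = 0%N.
    have [//|n1] := posnP (narcs s1); have [[pth1 _ _] _] := ss1.
    have := lt_le_trans (arc_sum_gt0 (@usage_gt0 _ _ I) pth1 n1) suse.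
    by rewrite /total_usage n2 big_ord0 ltxx.
  by rewrite !cat_nseqt_nil.
have /(reach_cat _ _ pp2 ss2 n2 ext2)[t2 [b2 [r2' st2]]] := rc2.
have [_ b2B] := reach_bounds pp2 r2'.
have bet := state_le_trans pbet (opt2 _ _ r2').
case: (posnP (narcs s1)) => [n1|n1].
  rewrite (cat_nseqt_nil p1 n1); split=> //.
  exact: state_le_trans bet (step_state_le ss2 b2B st2).
have [_ b1B] := reach_bounds pp1 r1.
have [ts [bs best]] := step_best (path_end_min I p1) ss1 b1B.
have {best}[st1 bet'] := best _ _ _ _ _ ss2 sst sL sE sQ suse b2B
  (depot_battery_eq pp1 pp2 sst ext1 ext2 r1 r2') bet st2.
have rc1 : reach I (cat_nseqt p1 s1) ts bs.
  by apply/reach_cat => //; exists (path_end_min I p1), (path_battery_max I p1).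
have fc1 : feasible_path I (cat_nseqt p1 s1).
  apply/feasible_pathP; split; [exact: partial_path_cat|exact: le_trans loadc _|].
  exists ts, bs; apply/visit_cat => //; split; first by have [] := (feasible_subpathP I s1).1 fs1.
  exists (path_end_min I p1), (path_battery_max I p1); split=> //.
  exact/visit_reach.
split=> //; have [_ optc] := feasible_path_optimum fc1.
exact: state_le_trans (optc _ _ rc1) bet'.
Qed.

End Domination.

Theorem theorem1 (R : realType) (V : finType) (I : instance R V)
    (kappa mu nu : V -> R) :
  (forall (s1 s2 : nseqt V) (a : V * V),
     feasible_subpath I s1 -> feasible_subpath I s2 ->
     sub_dominates I kappa mu nu s1 s2 ->
     arc_extends I a s1 -> arc_extends I a s2 ->
     feasible_subpath I (cat_arc s2 a) ->
     feasible_subpath I (cat_arc s1 a) /\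
     sub_dominates I kappa mu nu (cat_arc s1 a) (cat_arc s2 a)) /\
  (forall p1 p2 s : nseqt V,
     feasible_path I p1 -> feasible_path I p2 ->
     path_dominates I kappa mu nu p1 p2 ->
     subpath I s -> feasible_subpath I s ->
     sub_extends I s p1 -> sub_extends I s p2 ->
     feasible_path I (cat_nseqt p2 s) ->
     feasible_path I (cat_nseqt p1 s) /\
     path_dominates I kappa mu nu (cat_nseqt p1 s) (cat_nseqt p2 s)) /\
  (forall s1 s2 p : nseqt V,
     subpath I s1 -> feasible_subpath I s1 ->
     subpath I s2 -> feasible_subpath I s2 ->
     sub_dominates I kappa mu nu s1 s2 ->
     feasible_path I p ->
     sub_extends I s1 p -> sub_extends I s2 p ->
     feasible_path I (cat_nseqt p s2) ->
     feasible_path I (cat_nseqt p s1) /\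
     path_dominates I kappa mu nu (cat_nseqt p s1) (cat_nseqt p s2)).
Proof.
split; [|split].
- by move=> s1 s2 a fs1 _ dom a1 _; exact: sub_dominates_arc.
- move=> p1 p2 s f1 f2 dom ss fs ext1 ext2.
  by apply: path_dominates_cat => //; split.
- move=> s1 s2 p ss1 fs1 ss2 _ dom f ext1 ext2.
  by apply: path_dominates_cat => //; apply/path_dominatesP.
Qed.
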